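(* Let $f(z_1,z_2)$ be a function analytic at the origin which reduces to $z_1$ in the weak field limit, and consider the self-interacting action $$S^I=\int d^4x\left(\tfrac12\,\mathcal H^\alpha_m\tilde{\mathcal H}^{\alpha m}-f(z_1,z_2)\right),\qquad z_1=\tfrac12\tilde{\mathcal H}^\alpha_p\tilde{\mathcal H}^{\alpha p},\quad z_2=\tfrac14\tilde{\mathcal H}^\alpha_p\tilde{\mathcal H}^{\beta p}\tilde{\mathcal H}^\alpha_q\tilde{\mathcal H}^{\beta q},$$ for two one-form gauge potentials $A^\alpha_m$ ($\alpha=1,2$) and a scalar $a$ on four-dimensional Minkowski space. Put $f_1=\partial f/\partial z_1$, $f_2=\partial f/\partial z_2$ and $$J^\alpha_p=\frac{\partial f}{\partial\tilde{\mathcal H}^{\alpha p}}=f_1\tilde{\mathcal H}^\alpha_p+f_2\,\tilde{\mathcal H}^\beta_p\tilde{\mathcal H}^{\beta q}\tilde{\mathcal H}^\alpha_q .$$ If $f$ satisfies the equation $$f_1^2+2z_1f_1f_2+2(z_1^2-z_2)f_2^2=1,$$ then both of the following are invariant under the infinitesimal gauge transformations $$\delta A_m^\alpha=\mathcal L^{\beta\alpha}\left(\mathcal H^\beta_m-J^\beta_m\right)\frac{\phi}{\sqrt{-u^2}},\qquad \delta a=\phi,$$ with arbitrary function $\phi(x)$: (i) the deformed self-duality condition $\mathcal H^\alpha_p=J^\alpha_p$ (that is, on configurations satisfying it, $\delta\mathcal H^\alpha_p=\delta J^\alpha_p$); (ii) the action $S^I$, up to total derivatives.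
   Context: Metric signature is mostly plus, $\eta={\rm diag}(-,+,+,+)$; $m,n,p,q$ are Lorentz indices and repeated indices (including $\alpha,\beta\in\{1,2\}$) are summed. $\mathcal L^{\alpha\beta}$ is antisymmetric with $\mathcal L^{12}=1$. The scalar field $a(x)$ has time-like gradient $u_m=\partial_ma$, i.e. $u^2=u^mu_m<0$, and $v_m=u_m/\sqrt{-u^2}$. Further $F^\alpha_{mn}=\partial_mA^\alpha_n-\partial_nA^\alpha_m$, $F^{*\alpha}_{mn}=\frac12\epsilon_{mnpq}F^{\alpha pq}$ with $\epsilon_{mnpq}$ the totally antisymmetric Levi-Civita tensor ($\epsilon_{0123}=-\epsilon^{0123}=1$), and $$\mathcal H^\alpha_m=\mathcal L^{\beta\alpha}v^nF^\beta_{nm},\qquad \tilde{\mathcal H}^\alpha_m=v^nF^{*\alpha}_{nm}.$$ The case $f=z_1$ is the free Pasti–Sorokin–Tonin action. *)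

(* Defs.v *)
From HB Require Import structures.
From mathcomp Require Import all_boot all_order all_algebra.
From mathcomp Require Import all_classical all_reals all_analysis.

Set Implicit Arguments.
Unset Strict Implicit.
Unset Printing Implicit Defensive.

Import Order.TTheory GRing.Theory Num.Theory.
Import numFieldNormedType.Exports.

Local Open Scope classical_set_scope.
Local Open Scope ring_scope.

(* Conventions. Minkowski space is 'rV[R]_4 with x^0 the time coordinate;
   Lorentz indices are m, n, p, q : 'I_4. The internal indices
   alpha, beta in {1, 2} are represented by 'I_2 = {0, 1}. All tensors are
   given by their components with lower Lorentz indices. *)

Section Calculus.
Variable R : realType.

(* The partial derivative with respect to x^m. *)
Definition pd (m : 'I_4) (g : 'rV[R]_4 -> R) : 'rV[R]_4 -> R :=
  fun x => 'D_(delta_mx 0 m : 'rV[R]_4) g x.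

Definition pds (s : seq 'I_4) (g : 'rV[R]_4 -> R) : 'rV[R]_4 -> R :=
  foldr pd g s.

(* C^infinity: a function is smooth iff all its iterated partial derivatives
   exist and are (Frechet) differentiable everywhere. *)
Definition smooth (g : 'rV[R]_4 -> R) : Prop :=
  forall (s : seq 'I_4) (x : 'rV[R]_4), differentiable (pds s g) x.

(* The k-jet of g at x: the family of all its partial derivatives of order at
   most k at x. *)
Definition jet (k : nat) (g : 'rV[R]_4 -> R) (x : 'rV[R]_4) :
    seq 'I_4 -> R :=
  fun s => if (size s <= k)%N then pds s g x else 0.

(* f is the sum of an absolutely convergent double power series around p; the
   series is summed along the homogeneous parts, of total degree n. *)
Definition analytic_at (f : R -> R -> R) (p : R * R) : Prop :=
  exists (c : nat -> nat -> R) (r : R), 0 < r /\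
    forall h1 h2 : R, `|h1| < r -> `|h2| < r ->
      cvgn (series (fun n : nat =>
        \sum_(i < n.+1) `|c i (n - i)%N * h1 ^+ i * h2 ^+ (n - i)|)) /\
      series (fun n : nat =>
        \sum_(i < n.+1) c i (n - i)%N * h1 ^+ i * h2 ^+ (n - i)) @ \oo
        --> f (p.1 + h1) (p.2 + h2).

(* The partial derivatives f_1 and f_2. *)
Definition partial1 (f : R -> R -> R) (z1 z2 : R) : R :=
  derive1 (fun s : R => f s z2) z1.

Definition partial2 (f : R -> R -> R) (z1 z2 : R) : R :=
  derive1 (fun s : R => f z1 s) z2.

End Calculus.
Arguments analytic_at {R} f p.
Arguments partial1 {R} f z1 z2.
Arguments partial2 {R} f z1 z2.

Section Tensors.
Variable R : realType.

(* The diagonal entries of diag(-,+,+,+): as this matrix is its own inverse,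
   V^m = metric m * V_m (no sum) and V^m W_m = \sum_m metric m * V_m * W_m. *)
Definition metric (m : 'I_4) : R := if m == 0 then -1 else 1.

(* The totally antisymmetric symbol, with lower indices and value 1 at
   (0,1,2,3). *)
Definition levi_civita (m n p q : 'I_4) : R :=
  let d (i j : 'I_4) : R := Num.sg ((j : nat)%:R - (i : nat)%:R) in
  d m n * d m p * d m q * d n p * d n q * d p q.

(* The antisymmetric 2 x 2 tensor whose (1,2) entry is 1, i.e. the entry (0,1)
   for indices in 'I_2. *)
Definition Leps (al be : 'I_2) : R := (be : nat)%:R - (al : nat)%:R.

(* The matrix h : 'M_(2, 4) stands for the components h^alpha_m. *)
Definition inner (h : 'M[R]_(2, 4)) (al be : 'I_2) : R :=
  \sum_(p < 4) metric p * h al p * h be p.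

Definition z1 (h : 'M[R]_(2, 4)) : R :=
  2^-1 * \sum_(al < 2) inner h al al.

Definition z2 (h : 'M[R]_(2, 4)) : R :=
  4^-1 * \sum_(al < 2) \sum_(be < 2) inner h al be * inner h al be.

Definition J (f : R -> R -> R) (h : 'M[R]_(2, 4)) : 'M[R]_(2, 4) :=
  \matrix_(al < 2, p < 4)
    (partial1 f (z1 h) (z2 h) * h al p +
     partial2 f (z1 h) (z2 h) *
       \sum_(be < 2) h be p * \sum_(q < 4) metric q * h be q * h al q).

End Tensors.
Arguments metric {R} m.
Arguments levi_civita {R} m n p q.
Arguments Leps {R} al be.
Arguments inner {R} h al be.
Arguments z1 {R} h.
Arguments z2 {R} h.
Arguments J {R} f h.

(* The gauge potentials A^alpha_m and the scalar field a. *)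
Record config (R : realType) := Config {
  gauge : 'I_2 -> 'I_4 -> 'rV[R]_4 -> R ;
  scal : 'rV[R]_4 -> R }.

Section Model.
Variable R : realType.
Implicit Types (c : config R) (x : 'rV[R]_4).

Definition u c (m : 'I_4) x : R := pd m (scal c) x.

(* u^m u_m *)
Definition usq c x : R := \sum_(m < 4) metric m * u c m x * u c m x.

Definition v c (m : 'I_4) x : R := u c m x / Num.sqrt (- usq c x).

Definition F c (al : 'I_2) (m n : 'I_4) x : R :=
  pd m (gauge c al n) x - pd n (gauge c al m) x.

Definition Fdual c (al : 'I_2) (m n : 'I_4) x : R :=
  2^-1 * \sum_(p < 4) \sum_(q < 4)
    levi_civita m n p q * (metric p * metric q * F c al p q x).

Definition H c x : 'M[R]_(2, 4) :=
  \matrix_(al < 2, m < 4)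
    \sum_(be < 2) Leps be al * \sum_(n < 4) metric n * v c n x * F c be n m x.

Definition Htilde c x : 'M[R]_(2, 4) :=
  \matrix_(al < 2, m < 4) \sum_(n < 4) metric n * v c n x * Fdual c al n m x.

(* The integrand of the action. *)
Definition lagrangian (f : R -> R -> R) c x : R :=
  2^-1 * (\sum_(al < 2) \sum_(m < 4) metric m * H c x al m * Htilde c x al m)
  - f (z1 (Htilde c x)) (z2 (Htilde c x)).

(* Smooth configurations with time-like gradient of a, on which f is evaluated
   inside U. *)
Definition admissible (U : set (R * R)) c : Prop :=
  [/\ forall al m, smooth (gauge c al m),
      smooth (scal c),
      forall x, usq c x < 0 &
      forall x, U (z1 (Htilde c x), z2 (Htilde c x))].

Definition self_dual (f : R -> R -> R) c : Prop :=
  forall (al : 'I_2) (p : 'I_4) x, H c x al p = J f (Htilde c x) al p.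

Definition delta_gauge (f : R -> R -> R) c (phi : 'rV[R]_4 -> R)
    (al : 'I_2) (m : 'I_4) x : R :=
  (\sum_(be < 2) Leps be al * (H c x be m - J f (Htilde c x) be m)) *
    (phi x / Num.sqrt (- usq c x)).

(* (A + e * delta A, a + e * delta a) with delta a = phi. *)
Definition transform (f : R -> R -> R) c (phi : 'rV[R]_4 -> R) (e : R) :
    config R :=
  Config (fun al m x => gauge c al m x + e * delta_gauge f c phi al m x)
         (fun x => scal c x + e * phi x).

(* [has_variation f c phi X d]: the first order variation of X at c under the
   gauge transformation of parameter phi exists and equals d. *)
Definition has_variation (f : R -> R -> R) c (phi : 'rV[R]_4 -> R)
    (X : config R -> R) (d : R) : Prop :=
  is_derive (0 : R) (1 : R) (fun e : R => X (transform f c phi e)) d.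

(* The vector density K^m(x) given by a function kappa of the k-jets of the
   fields and of the gauge parameter at the point x. *)
Definition local_current (k : nat)
    (kappa : ('I_2 -> 'I_4 -> seq 'I_4 -> R) -> (seq 'I_4 -> R) ->
             (seq 'I_4 -> R) -> 'I_4 -> R)
    c (phi : 'rV[R]_4 -> R) (m : 'I_4) x : R :=
  kappa (fun al n => jet k (gauge c al n) x) (jet k (scal c) x)
        (jet k phi x) m.

(* The action is invariant up to total derivatives: the variation of its
   integrand is the divergence of a local current. Locality is essential, as
   any function on 'rV[R]_4 is the divergence of some vector field. *)
Definition action_invariant (f : R -> R -> R) (U : set (R * R)) : Prop :=
  exists (k : nat)
         (kappa : ('I_2 -> 'I_4 -> seq 'I_4 -> R) -> (seq 'I_4 -> R) ->
                  (seq 'I_4 -> R) -> 'I_4 -> R),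
    forall c (phi : 'rV[R]_4 -> R), admissible U c -> smooth phi ->
      (forall m, smooth (local_current k kappa c phi m)) /\
      forall x, has_variation f c phi (fun c' => lagrangian f c' x)
        (\sum_(m < 4) pd m (local_current k kappa c phi m) x).

Definition self_duality_invariant (f : R -> R -> R) (U : set (R * R)) : Prop :=
  forall c (phi : 'rV[R]_4 -> R), admissible U c -> smooth phi ->
    self_dual f c ->
    forall (al : 'I_2) (p : 'I_4) x, exists d : R,
      has_variation f c phi (fun c' => H c' x al p) d /\
      has_variation f c phi (fun c' => J f (Htilde c' x) al p) d.

End Model.

(* Main.v *)
Require Import Defs.
From HB Require Import structures.
From mathcomp Require Import all_boot all_order all_algebra.
From mathcomp Require Import all_classical all_reals all_analysis.
From mathcomp Require Import ring lra.
Import Order.TTheory GRing.Theory Num.Theory.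
Import numFieldNormedType.Exports.
Local Open Scope classical_set_scope.
Local Open Scope ring_scope.

(* Decompose the field strengths along [v] into the electric parts [E] and the
   magnetic parts [B = Htilde]. The equation of [f] says that the 2 x 2 matrix
   [f1 + f2 G], [G] the Gram matrix of [B1], [B2], has determinant 1; as this
   matrix maps [(B1, B2)] to [(J1, J2)], it means [J1 /\ J2 = B1 /\ B2].

   Action: up to a total derivative the variation of the Lagrangian under
   [delta A] is [(H - J) . delta Htilde]. With [Z = (H - J) / sqrt (- u^2)] the
   gauge variation is [delta A = L Z phi], and since [u] is closed, this equals
   another total derivative plus a multiple of [vol u (d phi) Z1 Z2]. Expanding [Z]
   in [E] and [J], that last term cancels the variation under [delta a = phi]
   exactly when [J1 /\ J2 = B1 /\ B2].

   Self-duality: on shell [delta A = 0], so only [v] varies. Differentiating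
   [J1 /\ J2 = B1 /\ B2] in an arbitrary direction and using the symmetry of the
   Hessian of [f] gives [delta J = delta H]. *)

Set Implicit Arguments.
Unset Strict Implicit.
Unset Printing Implicit Defensive.

(** * Termwise differentiation of double power series *)

(** The determinant is $f_1^2 + f_1 f_2\,{\rm tr}\,G + f_2^2 \det G$, where ${\rm tr}\,G = 2 z_1$
    and $2\det G = ({\rm tr}\,G)^2 - {\rm tr}\,G^2 = 4(z_1^2 - z_2)$: this is the left side of the
    equation. As [B1], [B2] and hence [J1], [J2] are orthogonal to [v], their wedge product is
    tested by [vol v k J1 J2]. The variation [k] of the unit covector [v] is itself orthogonal to
    [v], so varying [v] produces only such volumes when all other vectors are orthogonal to [v].

    Two obstacles shape the development. Analyticity only gives the sum of a series around each
    point of [U]; that the partial derivatives are analytic again, that [f] is jointly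
    differentiable and that its mixed derivatives agree must be extracted from the coefficients, by
    a remainder bound quadratic in the increment and summable over the degrees. And total
    derivatives cannot simply be dropped: they must be the divergence of a smooth current built from
    jets. The current contains [Z], hence [f1], [f2] and an inverse square root of the fields, which
    calls for closure properties of smooth functions; its divergence simplifies only because second
    derivatives commute. *)

Section QuadraticRemainder.
Variable R : realType.

(** A bound by [M * |h| ^+ 2], unlike a little-o, can be summed over the terms of a series. *)
Lemma is_diff_quadratic (V : normedModType R) (g : V -> R) (x : V)
  (dg : V -> R) (M e : R) : (forall a u w, dg (a *: u + w) = a * dg u + dg w) ->
  continuous dg -> 0 < e ->
  (forall h, `|h| < e -> `|g (h + x) - g x - dg h| <= M * `|h| ^+ 2) ->
  is_diff x g dg.
Proof.
move=> dgl dgc e0 gM.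
pose dgL := GRing.isLinear.Build R V R^o *:%R dg dgl.
pose dg' : {linear V -> R^o} := HB.pack dg dgL.
suff dg0 : g \o shift x = cst (g x) + dg +o_ 0 id.
  have E := @diff_unique _ _ R^o g dg' x dgc dg0.
  by split => //; apply/diff_locallyP; rewrite E.
apply/eqaddoP => _ /posnumP[d].
have M1 : 0 < `|M| + 1 by rewrite ltr_wpDl.
(* Below d / (|M| + 1) one has M |h|^2 <= d |h|; adding 1 keeps the denominator positive. *)
apply/nbhs_normP; exists (Num.min e (d%:num / (`|M| + 1))).
  by rewrite /= lt_min e0 divr_gt0.
move=> h /=; rewrite sub0r normrN lt_min => /andP[he hd].
rewrite !fctE /= opprD addrA (le_trans (gM _ he))//.
apply: (@le_trans _ _ ((`|M| + 1) * `|h| ^+ 2)).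
  by rewrite ler_wpM2r ?exprn_ge0// (le_trans (ler_norm M))// lerDl.
rewrite expr2 mulrA ler_wpM2r//.
by move: hd; rewrite ltr_pdivlMr// mulrC => /ltW.
Qed.

Lemma is_derive_quadratic (g : R -> R) (x L M e : R) : 0 < e ->
  (forall h, `|h| < e -> `|g (x + h) - g x - h * L| <= M * h ^+ 2) ->
  is_derive x 1 g L.
Proof.
move=> e0 gM.
have D : is_diff x g ( *%R^~ L).
  apply: (@is_diff_quadratic R^o _ _ _ M e) => //.
  - by move=> a u w; rewrite mulrDl -mulrA.
  - exact: mulrr_continuous.
  - by move=> h he; rewrite [h + x]addrC real_normK ?num_real//; exact: gM.
split; first by apply/derivable1_diffP.
by rewrite deriveE// diff_val mul1r.
Qed.

End QuadraticRemainder.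

Section PowerSums.
Variable R : realType.
Implicit Types (t q x k : R) (a b : nat -> R).

(** The factor rho^2 on the left stands for rho^(n-2) on the right, which treats n < 2 and rho = 0
    uniformly. The remainders satisfy R_(n+1) = (x + k) R_n + k^2 n x^(n-1), and the induction
    closes because n^2 + n <= (n + 1)^2. *)
Lemma exprD_linear_remainder x k (rho : R) n : `|x| <= rho -> `|x + k| <= rho ->
  `|(x + k) ^+ n - x ^+ n - k * (n%:R * x ^+ n.-1)| * rho ^+ 2
    <= k ^+ 2 * (n%:R ^+ 2 * rho ^+ n).
Proof.
move=> xr xkr; have r0 : 0 <= rho by exact: le_trans xr.
elim: n => [|n IH]; first by rewrite !expr0 subrr mul0r mulr0 subrr normr0 !mul0r expr0n/= mul0r mulr0.
have -> : (x + k) ^+ n.+1 - x ^+ n.+1 - k * (n.+1%:R * x ^+ n.+1.-1) =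
   (x + k) * ((x + k) ^+ n - x ^+ n - k * (n%:R * x ^+ n.-1)) +
   k ^+ 2 * (n%:R * x ^+ n.-1).
  case: n {IH} => [|n] /=; first by rewrite !expr0 !expr1; ring.
  by rewrite !exprS -[n.+2%:R]natr1 -[n.+1%:R]natr1; ring.
apply: (@le_trans _ _ (rho * (k ^+ 2 * (n%:R ^+ 2 * rho ^+ n)) +
    k ^+ 2 * (n%:R * rho ^+ n.+1))); last first.
  rewrite -natr1 [rho ^+ n.+1]exprS.
  have : 0 <= k ^+ 2 * (rho * rho ^+ n) by rewrite mulr_ge0 ?sqr_ge0// mulr_ge0// exprn_ge0.
  have : 0 <= n%:R :> R by [].
  by move: (n%:R : R) (rho ^+ n) (k ^+ 2) => a b d; nra.
apply: le_trans (_ : (`|x + k| * `|(x + k) ^+ n - x ^+ n - k * (n%:R * x ^+ n.-1)|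
    + k ^+ 2 * (n%:R * `|x| ^+ n.-1)) * rho ^+ 2 <= _).
  rewrite ler_wpM2r ?sqr_ge0// (le_trans (ler_normD _ _))// !normrM.
  by rewrite lerD2l normrX (ger0_norm (_ : 0 <= n%:R))// -expr2 real_normK ?num_real.
rewrite mulrDl lerD//.
  rewrite -mulrA ler_pM// ?mulr_ge0 ?sqr_ge0//.
rewrite -mulrA -[n%:R * _ * _]mulrA ler_wpM2l ?sqr_ge0//.
case: n {IH} => [|n] /=; first by rewrite !mul0r.
by rewrite ler_wpM2l// -[n.+2]addn2 exprD ler_wpM2r ?sqr_ge0// lerXn2r.
Qed.

(** The right side is 1 - t times a geometric sum of n + 1 terms, each at least t^n. *)
Lemma natr_mul_expr_bounded t n : 0 <= t < 1 ->
  n.+1%:R * t ^+ n * (1 - t) <= 1 - t ^+ n.+1.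
Proof.
move=> /andP[t0 t1]; elim: n => [|n IH]; first by rewrite expr0 expr1 !mul1r.
have tn : t ^+ n.+1 <= 1 by rewrite exprn_ile1// ltW.
rewrite [t ^+ n.+2]exprS -natr1.
have : t * (n.+1%:R * t ^+ n * (1 - t)) <= t * (1 - t ^+ n.+1) by rewrite ler_wpM2l.
rewrite [t ^+ n.+1]exprS in tn *.
have tn0 : 0 <= t ^+ n by rewrite exprn_ge0.
by move: (n.+1%:R : R) (t ^+ n) tn tn0 => a b; nra.
Qed.

Lemma sqr_natr_mul_expr_bounded q : 0 <= q < 1 ->
  exists2 C : R, 0 <= C & forall n, n.+1%:R ^+ 2 * q ^+ n <= C.
Proof.
(* With t = sqrt q the sequence is the square of (n + 1) t^n, which is at most 1 / (1 - t). *)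
move=> /andP[q0 q1]; pose t := Num.sqrt q.
have t0 : 0 <= t by exact: sqrtr_ge0.
have t1 : t < 1 by rewrite /t -sqrtr1 ltr_sqrt.
have qE : q = t ^+ 2 by rewrite sqr_sqrtr.
exists ((1 - t)^-1 ^+ 2); first exact: sqr_ge0.
move=> n; rewrite qE -exprM mulnC exprM -exprMn.
rewrite lerXn2r// ?nnegrE ?mulr_ge0 ?exprn_ge0 ?invr_ge0 ?subr_ge0 ?(ltW t1)//.
rewrite -[leRHS]mul1r ler_pdivlMr ?subr_gt0//.
apply: le_trans (natr_mul_expr_bounded n _) _; first by rewrite t0.
by rewrite gerBl exprn_ge0.
Qed.

Lemma cvg_seriesS a (l : R) : series a @ \oo --> l ->
  series (fun n => a n.+1) @ \oo --> l - a 0%N.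
Proof.
move=> al.
have -> : series (fun n => a n.+1) = (fun n => series a n.+1 - a 0%N).
  by apply/funext => n; rewrite /series/= big_nat_recl//= addrC addKr.
by apply: cvgB; [rewrite cvg_shiftS|exact: cvg_cst].
Qed.

Lemma is_cvg_seriesS a : cvgn (series a) -> cvgn (series (fun n => a n.+1)).
Proof. by move=> /cvg_ex[l al]; apply/cvg_ex; exists (l - a 0%N); exact: cvg_seriesS. Qed.

Lemma normr_cvg_series_le a b (l : R) : series a @ \oo --> l -> cvgn (series b) ->
  (forall n, `|a n| <= b n) -> `|l| <= limn (series b).
Proof.
move=> al cb ab.
have cna : cvgn [normed series a].
  apply: series_le_cvg cb => // n; first exact: normr_ge0.
  exact: le_trans (normr_ge0 _) (ab n).
rewrite -(cvg_lim _ al)//; apply: le_trans (@lim_series_norm _ R^o _ cna) _.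
exact: lim_series_le.
Qed.

(** The gap between the radii absorbs the weight, since n^2 (rho0 / rho1)^n is bounded. The weight
    is the one in [exprD_linear_remainder]. *)
Lemma is_cvg_series_sqr_natr_mul a (rho0 rho1 : R) : (forall n, 0 <= a n) ->
  0 <= rho0 < rho1 -> cvgn (series (fun n => a n * rho1 ^+ n)) ->
  cvgn (series (fun n => a n.+1 * (n.+1%:R ^+ 2 * rho0 ^+ n))).
Proof.
move=> a0 /andP[r0 r01] ca; have r1 : 0 < rho1 by exact: le_lt_trans r01.
have [C C0 HC] : exists2 C : R, 0 <= C & forall n, n.+1%:R ^+ 2 * (rho0 / rho1) ^+ n <= C.
  by apply: sqr_natr_mul_expr_bounded; rewrite divr_ge0 ?(ltW r1)//= ltr_pdivrMr ?mul1r.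
have := @is_cvg_seriesZ R _ (C / rho1) (is_cvg_seriesS ca).
apply: series_le_cvg => n.
- by rewrite mulr_ge0 ?mulr_ge0 ?sqr_ge0 ?exprn_ge0.
- by rewrite /= mulr_ge0 ?divr_ge0 ?mulr_ge0 ?exprn_ge0 ?(ltW r1).
- have -> : (C / rho1 *: (fun n => a n.+1 * rho1 ^+ n.+1)) n = a n.+1 * (C * rho1 ^+ n).
    transitivity (C / rho1 * (a n.+1 * rho1 ^+ n.+1)) => //.
    by rewrite exprS; field; rewrite gt_eqF.
  rewrite ler_wpM2l// -ler_pdivrMr ?exprn_gt0//.
  by apply: le_trans (HC n); rewrite expr_div_n mulrA.
Qed.

End PowerSums.

(** * Power series in two variables and their partial derivatives *)

Section DoublePowerSeries.
Variable R : realType.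
Implicit Types (c : nat -> nat -> R) (f : R -> R -> R) (p : R * R) (r : R).

Definition homog c n (h1 h2 : R) : R :=
  \sum_(i < n.+1) c i (n - i)%N * h1 ^+ i * h2 ^+ (n - i).

Definition abs_coef c n : R := \sum_(i < n.+1) `|c i (n - i)%N|.

(** Absolute convergence is imposed on a majorant in the single variable [rho], so that estimates in
    two variables become comparisons of ordinary power series. *)
Definition has_power_series f p c r : Prop :=
  [/\ 0 < r,
      forall rho : R, 0 <= rho < r -> cvgn (series (fun n => abs_coef c n * rho ^+ n)) &
      forall h1 h2, `|h1| < r -> `|h2| < r ->
        series (fun n => homog c n h1 h2) @ \oo --> f (p.1 + h1) (p.2 + h2)].

Lemma abs_coef_ge0 c n : 0 <= abs_coef c n.
Proof. by rewrite sumr_ge0. Qed.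

Lemma homog_abs_le c n h1 h2 rho : `|h1| <= rho -> `|h2| <= rho ->
  \sum_(i < n.+1) `|c i (n - i)%N * h1 ^+ i * h2 ^+ (n - i)| <= abs_coef c n * rho ^+ n.
Proof.
move=> h1r h2r; rewrite mulr_suml ler_sum// => i _.
have r0 : 0 <= rho by exact: le_trans h1r.
rewrite !normrM -mulrA ler_wpM2l// -[in leRHS](subnKC (ltnSE (ltn_ord i))) exprD.
by rewrite !normrX ler_pM// ?exprn_ge0// lerXn2r// nnegrE.
Qed.

(** At h1 = h2 = rho the absolute series is exactly the majorant; conversely the majorant at rho =
    max(|h1|, |h2|) dominates it. *)
Lemma analytic_atP f p : analytic_at f p <-> exists c r, has_power_series f p c r.
Proof.
split=> -[c [r]].
  move=> [r0 H]; exists c, r; split=> //.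
    move=> rho /andP[rho0 rhor].
    have rr : `|rho| < r by rewrite ger0_norm.
    have [+ _] := H _ _ rr rr.
    suff -> : (fun n => \sum_(i < n.+1) `|c i (n - i)%N * rho ^+ i * rho ^+ (n - i)|) =
      (fun n => abs_coef c n * rho ^+ n) by [].
    apply/funext => n; rewrite mulr_suml; apply: eq_bigr => i _.
    by rewrite -mulrA -exprD subnKC ?(ltnSE (ltn_ord i))// normrM normrX (ger0_norm rho0).
  by move=> h1 h2 h1r h2r; have [_] := H _ _ h1r h2r.
move=> [r0 cvg_c cvg_f]; exists c, r; split=> // h1 h2 h1r h2r.
split; last exact: cvg_f.
have /cvg_c : 0 <= Num.max `|h1| `|h2| < r by rewrite gt_max h1r h2r le_max normr_ge0.
apply: series_le_cvg => n; [by rewrite sumr_ge0| |].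
  by rewrite mulr_ge0 ?abs_coef_ge0 ?exprn_ge0// le_max normr_ge0.
by rewrite homog_abs_le// le_max lexx ?orbT.
Qed.

Definition dcoef1 c i j : R := i.+1%:R * c i.+1 j.

Lemma abs_coef_dcoef1 c n : abs_coef (dcoef1 c) n <= n.+1%:R * abs_coef c n.+1.
Proof.
rewrite /abs_coef [X in _ <= _ * X]big_ord_recl/= mulrDr -[leLHS]add0r lerD ?mulr_ge0// mulr_sumr ler_sum// => i _.
rewrite /dcoef1 normrM /bump /= add1n subSS ger0_norm// ler_wpM2r// ler_nat.
exact: ltn_ord.
Qed.

(** The monomial without h1 cancels in the difference, and in the others h2 is a spectator: only
    one-variable remainders are left. *)
Lemma homogS_shift c n h1 k h2 :
  homog c n.+1 (h1 + k) h2 - homog c n.+1 h1 h2 - k * homog (dcoef1 c) n h1 h2 =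
  \sum_(i < n.+1) c i.+1 (n - i)%N * h2 ^+ (n - i) *
    ((h1 + k) ^+ i.+1 - h1 ^+ i.+1 - k * (i.+1%:R * h1 ^+ i)).
Proof.
rewrite /homog big_ord_recl [X in _ - X - _]big_ord_recl /= !expr0.
rewrite opprD addrACA subrr add0r mulr_sumr -!sumrB; apply: eq_bigr => i _.
rewrite /bump/= add1n subSS /dcoef1; ring.
Qed.

Lemma homogS_shift_le c n h1 k h2 (rho : R) :
  `|h1| <= rho -> `|h1 + k| <= rho -> `|h2| <= rho ->
  `|homog c n.+1 (h1 + k) h2 - homog c n.+1 h1 h2 - k * homog (dcoef1 c) n h1 h2|
     * rho ^+ 2 <= k ^+ 2 * (abs_coef c n.+1 * (n.+1%:R ^+ 2 * rho ^+ n.+1)).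
Proof.
move=> h1r h1kr h2r; have r0 : 0 <= rho by exact: le_trans h1r.
rewrite homogS_shift.
apply: (@le_trans _ _ (\sum_(i < n.+1) `|c i.+1 (n - i)%N| *
    (k ^+ 2 * (n.+1%:R ^+ 2 * rho ^+ n.+1)))); last first.
  rewrite -mulr_suml [leRHS]mulrCA ler_wpM2r//; first by rewrite mulr_ge0 ?sqr_ge0// mulr_ge0 ?sqr_ge0 ?exprn_ge0.
  by rewrite /abs_coef [leRHS]big_ord_recl/= -[leLHS]add0r lerD.
apply: (@le_trans _ _ ((\sum_(i < n.+1) `|c i.+1 (n - i)%N * h2 ^+ (n - i) *
    ((h1 + k) ^+ i.+1 - h1 ^+ i.+1 - k * (i.+1%:R * h1 ^+ i))|) * rho ^+ 2)).
  by rewrite ler_wpM2r ?sqr_ge0// ler_norm_sum.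
rewrite mulr_suml ler_sum// => i _.
have := @exprD_linear_remainder _ h1 k rho i.+1 h1r h1kr => /= D.
rewrite 2!normrM -2!mulrA ler_wpM2l//.
apply: (@le_trans _ _ (rho ^+ (n - i) * (k ^+ 2 * (i.+1%:R ^+ 2 * rho ^+ i.+1)))).
  rewrite -mulrA ler_pM ?mulr_ge0 ?sqr_ge0 ?normr_ge0//.
  by rewrite normrX lerXn2r// nnegrE.
rewrite mulrCA ler_wpM2l ?sqr_ge0// mulrCA -exprD addnS subnK ?(ltnSE (ltn_ord i))//.
by rewrite ler_wpM2r ?exprn_ge0// lerXn2r ?nnegrE// ler_nat ltn_ord.
Qed.

Lemma has_power_series_bound f p c r (rho : R) : has_power_series f p c r ->
  0 <= rho < r -> cvgn (series (fun n => abs_coef c n.+1 * (n.+1%:R ^+ 2 * rho ^+ n))).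
Proof.
move=> [r0 cvg_c _] /andP[rho0 rhor].
apply: (@is_cvg_series_sqr_natr_mul _ _ _ ((rho + r) / 2)).
- exact: abs_coef_ge0.
- by rewrite rho0/= midf_lt.
- by apply: cvg_c; rewrite !midf_lt// divr_ge0// addr_ge0// ltW.
Qed.

Lemma abs_coef_dcoef1_bound c n (rho : R) : 0 <= rho ->
  abs_coef (dcoef1 c) n * rho ^+ n <= abs_coef c n.+1 * (n.+1%:R ^+ 2 * rho ^+ n).
Proof.
move=> r0; rewrite mulrA ler_wpM2r ?exprn_ge0//.
apply: le_trans (abs_coef_dcoef1 _ _) _; rewrite mulrC ler_wpM2l ?abs_coef_ge0//.
by rewrite expr2 ler_peMl// ler1n.
Qed.

Lemma cvg_homog_dcoef1 f p c r h1 h2 : has_power_series f p c r ->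
  `|h1| < r -> `|h2| < r -> cvgn (series (fun n => homog (dcoef1 c) n h1 h2)).
Proof.
move=> fc h1r h2r; pose rho := Num.max `|h1| `|h2|.
have rho0 : 0 <= rho < r by rewrite gt_max h1r h2r le_max normr_ge0.
have B := has_power_series_bound fc rho0; move: rho0 => /andP[rho0 rhor].
apply: (@normed_cvg _ R^o); apply: series_le_cvg B => n//.
- exact: normr_ge0.
- by rewrite mulr_ge0 ?abs_coef_ge0 ?mulr_ge0 ?exprn_ge0.
apply: le_trans _ (abs_coef_dcoef1_bound c n rho0).
apply: le_trans (ler_norm_sum _ _ _) _.
by apply: homog_abs_le; rewrite le_max lexx ?orbT.
Qed.

Lemma has_power_series_is_derive f p c r h1 h2 : has_power_series f p c r ->
  `|h1| < r -> `|h2| < r ->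
  is_derive (p.1 + h1) 1 (fun s => f s (p.2 + h2))
    (limn (series (fun n => homog (dcoef1 c) n h1 h2))).
Proof.
move=> fc h1r h2r; have [r0 _ cvg_f] := fc.
(* [rho] lies midway between the point and the boundary, which leaves room rho - m for the increment
   and strict room for convergence. *)
pose m := Num.max `|h1| `|h2|; pose rho := (m + r) / 2.
have mr : m < r by rewrite gt_max h1r h2r.
have m0 : 0 <= m by rewrite le_max normr_ge0.
have [mrho rhor] : m < rho /\ rho < r by rewrite !midf_lt.
have rho0 : 0 < rho by exact: le_lt_trans mrho.
have [h1m h2m] : `|h1| <= m /\ `|h2| <= m by rewrite !le_max !lexx orbT.
have B : cvgn (series (fun n => abs_coef c n.+1 * (n.+1%:R ^+ 2 * rho ^+ n))).
  by apply: has_power_series_bound fc _; rewrite (ltW rho0).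
set L := limn _; pose b n := abs_coef c n.+1 * (n.+1%:R ^+ 2 * rho ^+ n).
(* [homogS_shift_le] has rho^2 on its left and rho^(n+1) on its right; dividing leaves the bound
   (k^2 / rho) b_n, whence the constant. *)
apply: (@is_derive_quadratic _ _ _ _ (limn (series b) / rho) (rho - m)).
  by rewrite subr_gt0.
move=> k km.
have h1kr : `|h1 + k| <= rho.
  by rewrite (le_trans (ler_normD _ _))// -lerBrDl (le_trans (ltW km))// lerB.
have F1 := cvg_f _ _ (le_lt_trans h1kr rhor) h2r.
have F0 := cvg_f _ _ h1r h2r.
have F : series (fun n => homog c n.+1 (h1 + k) h2 - homog c n.+1 h1 h2
      - k * homog (dcoef1 c) n h1 h2) @ \oo -->
    f (p.1 + h1 + k) (p.2 + h2) - f (p.1 + h1) (p.2 + h2) - k * L.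
  have -> : series (fun n => homog c n.+1 (h1 + k) h2 - homog c n.+1 h1 h2
      - k * homog (dcoef1 c) n h1 h2) =
    (fun n => series (fun n => homog c n.+1 (h1 + k) h2) n
      - series (fun n => homog c n.+1 h1 h2) n
      - k * series (fun n => homog (dcoef1 c) n h1 h2) n).
    by apply/funext => n; rewrite /series/= !sumrB mulr_sumr.
  (* The parts of degree 0 are the same constant, so subtracting them lets all series start at
     degree 1. *)
  have -> : f (p.1 + h1 + k) (p.2 + h2) - f (p.1 + h1) (p.2 + h2) =
    (f (p.1 + (h1 + k)) (p.2 + h2) - homog c 0 (h1 + k) h2) -
    (f (p.1 + h1) (p.2 + h2) - homog c 0 h1 h2).
    by rewrite /homog !big_ord1 !expr0 addrA; ring.
  apply: cvgB; first by apply: cvgB; [exact: (cvg_seriesS F1)|exact: (cvg_seriesS F0)].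
  by apply: cvgMl_tmp; exact: cvg_homog_dcoef1 fc _ _.
rewrite [leRHS]mulrC mulrA.
have Bk : cvgn (series ((k ^+ 2 / rho) *: (b : nat -> R^o))) by exact: is_cvg_seriesZ.
have -> : k ^+ 2 * limn (series b) / rho = limn (series ((k ^+ 2 / rho) *: (b : nat -> R^o))).
  by rewrite lim_seriesZ// mulrAC.
apply: (normr_cvg_series_le F Bk) => n.
have := @homogS_shift_le c n h1 k h2 rho (le_trans h1m (ltW mrho)) h1kr (le_trans h2m (ltW mrho)).
rewrite -ler_pdivlMr ?exprn_gt0// => /le_trans; apply.
rewrite le_eqVlt; apply/orP; left; apply/eqP.
transitivity (k ^+ 2 / rho * b n) => //; rewrite /b.
by rewrite [rho ^+ n.+1]exprS; field; rewrite gt_eqF.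
Qed.

Lemma has_power_series_partial1 f p c r : has_power_series f p c r ->
  has_power_series (partial1 f) p (dcoef1 c) r.
Proof.
move=> fc; have [r0 _ _] := fc; split => //.
  move=> rho rho0; have B := has_power_series_bound fc rho0.
  move: rho0 => /andP[rho0 _]; apply: series_le_cvg B => n.
  - by rewrite mulr_ge0 ?abs_coef_ge0 ?exprn_ge0.
  - by rewrite mulr_ge0 ?abs_coef_ge0 ?mulr_ge0 ?exprn_ge0.
  - exact: abs_coef_dcoef1_bound.
move=> h1 h2 h1r h2r; have D := has_power_series_is_derive fc h1r h2r.
by rewrite /partial1 derive1E (@derive_val _ _ _ _ _ _ _ D); exact: cvg_homog_dcoef1 fc _ _.
Qed.

Lemma homog_swap c n h1 h2 : homog (fun i j => c j i) n h2 h1 = homog c n h1 h2.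
Proof.
rewrite /homog (reindex_inj rev_ord_inj)/=; apply: eq_bigr => i _.
by rewrite subSS subKn ?(ltnSE (ltn_ord i))// mulrAC.
Qed.

Lemma abs_coef_swap c n : abs_coef (fun i j => c j i) n = abs_coef c n.
Proof.
rewrite /abs_coef (reindex_inj rev_ord_inj)/=; apply: eq_bigr => i _.
by rewrite subSS subKn ?(ltnSE (ltn_ord i)).
Qed.

Lemma has_power_series_swap f p c r : has_power_series f p c r ->
  has_power_series (fun a b => f b a) (p.2, p.1) (fun i j => c j i) r.
Proof.
move=> [r0 cvg_c cvg_f]; split=> //.
  by move=> rho /cvg_c; under eq_fun do rewrite -abs_coef_swap.
move=> h1 h2 h1r h2r; under eq_fun do rewrite homog_swap.
exact: cvg_f.
Qed.

Definition dcoef2 c i j : R := j.+1%:R * c i j.+1.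

Lemma has_power_series_partial2 f p c r : has_power_series f p c r ->
  has_power_series (partial2 f) p (dcoef2 c) r.
Proof.
move=> /has_power_series_swap/has_power_series_partial1/has_power_series_swap.
by case: p.
Qed.

Lemma homog00 c n : homog c n 0 0 = if n == 0%N then c 0%N 0%N else 0.
Proof.
case: n => [|n]; first by rewrite /homog big_ord1 !expr0 !mulr1.
rewrite /homog big1// => i _.
have [i0|i0] := eqVneq (i : nat) 0%N; first by rewrite i0 subn0 [0 ^+ n.+1]expr0n mulr0.
by rewrite expr0n (negbTE i0) mulr0 mul0r.
Qed.

Lemma has_power_series_center f p c r : has_power_series f p c r -> f p.1 p.2 = c 0%N 0%N.
Proof.
move=> [r0 _ cvg_f].
have := cvg_f 0 0; rewrite normr0 !addr0 => /(_ r0 r0) F.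
suff : series (fun n => homog c n 0 0) @ \oo --> c 0%N 0%N.
  exact: (@cvg_unique _ (@norm_hausdorff _ R^o) _ _ _ _ F).
rewrite -cvg_shiftS.
have -> : (fun n => series (fun n => homog c n 0 0) n.+1) = cst (c 0%N 0%N).
  apply/funext => n; rewrite /series/= big_nat_recl//= homog00 eqxx big1 ?addr0// => i _.
  by rewrite homog00.
exact: cvg_cst.
Qed.

Lemma homog_center_le c n h1 h2 (rho : R) : `|(h1, h2)| <= rho ->
  `|homog c n.+2 h1 h2| <= `|(h1, h2)| ^+ 2 * (abs_coef c n.+2 * rho ^+ n).
Proof.
move=> hr; have [h1m h2m] : `|h1| <= `|(h1, h2)| /\ `|h2| <= `|(h1, h2)|.
  by rewrite prod_normE/= !le_max !lexx orbT.
apply: le_trans (ler_norm_sum _ _ _) _; apply: le_trans (homog_abs_le _ _ h1m h2m) _.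
rewrite -[n.+2]addn2 exprD mulrA mulrC ler_wpM2l ?exprn_ge0// ler_wpM2l ?abs_coef_ge0//.
by rewrite lerXn2r// nnegrE// (le_trans _ hr).
Qed.

(** The parts of degree at least 2 form the quadratic remainder. The centre suffices for joint
    differentiability, as [f] has its own expansion at every point of [U];
    [has_power_series_is_derive] has to cover nearby points in order to identify [partial1 f] with a
    series. *)
Lemma has_power_series_is_diff f p c r : has_power_series f p c r ->
  is_diff p (fun z => f z.1 z.2) (fun k => k.1 * c 1%N 0%N + k.2 * c 0%N 1%N).
Proof.
move=> fc; have [r0 cvg_c cvg_f] := fc.
have B : cvgn (series (fun n => abs_coef c n.+2 * (r / 2) ^+ n)).
  have : cvgn (series (fun n => abs_coef c n * (r / 2) ^+ n)).
    by apply: cvg_c; rewrite divr_ge0 ?ltW//= ltr_pdivrMr// ltr_pMr// ltr1n.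
  move=> /is_cvg_seriesS/is_cvg_seriesS /(@is_cvg_seriesZ R _ ((r / 2) ^- 2)).
  suff -> : (r / 2) ^- 2 *: (fun n => abs_coef c n.+2 * (r / 2) ^+ n.+2) =
    (fun n => abs_coef c n.+2 * (r / 2) ^+ n) by [].
  apply/funext => n; transitivity ((r / 2) ^- 2 * (abs_coef c n.+2 * (r / 2) ^+ n.+2)) => //.
  have r20 : r / 2 != 0 by rewrite gt_eqF// divr_gt0.
  by move: (r / 2) r20 => q q0; rewrite [q ^+ n.+2]exprS [q ^+ n.+1]exprS; field.
apply: (@is_diff_quadratic _ _ _ p _ (limn (series (fun n => abs_coef c n.+2 * (r / 2) ^+ n))) (r / 2)).
- by move=> a u w; rewrite /= !mulrDl/= -!mulrA mulrDr; ring.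
- move=> z; apply: cvgD.
    by apply: cvgMr_tmp; exact: cvg_fst.
  by apply: cvgMr_tmp; exact: cvg_snd.
- by rewrite divr_gt0.
move=> [h1 h2] hr.
have hr' : `|(h1, h2)| < r by rewrite (lt_trans hr)// ltr_pdivrMr// ltr_pMr// ltr1n.
have [h1r h2r] : `|h1| < r /\ `|h2| < r.
  by move: hr'; rewrite prod_normE/= gt_max => /andP.
have F := cvg_seriesS (cvg_seriesS (cvg_f _ _ h1r h2r)).
rewrite /= ![_ + p.1]addrC ![_ + p.2]addrC (has_power_series_center fc).
have -> : f (p.1 + h1) (p.2 + h2) - c 0%N 0%N - (h1 * c 1%N 0%N + h2 * c 0%N 1%N)
   = f (p.1 + h1) (p.2 + h2) - homog c 0 h1 h2 - homog c 1 h1 h2.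
  by rewrite /homog big_ord1 !big_ord_recl big_ord0/= /bump/= /GRing.scale/=; ring.
have Bk : cvgn (series ((`|(h1, h2)| ^+ 2) *: (fun n => abs_coef c n.+2 * (r / 2) ^+ n : R^o))).
  exact: is_cvg_seriesZ.
rewrite [leRHS]mulrC -[leRHS]lim_seriesZ//.
apply: (normr_cvg_series_le F Bk) => n.
by apply: homog_center_le; exact: ltW.
Qed.

Lemma has_power_series_is_diff_partial f p c r : has_power_series f p c r ->
  is_diff p (fun z => f z.1 z.2)
    (fun k => k.1 * partial1 f p.1 p.2 + k.2 * partial2 f p.1 p.2).
Proof.
move=> fc.
rewrite (has_power_series_center (has_power_series_partial1 fc)).
rewrite (has_power_series_center (has_power_series_partial2 fc)).
by rewrite /dcoef1 /dcoef2 !mul1r; exact: has_power_series_is_diff fc.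
Qed.

Lemma analytic_at_partial1 f p : analytic_at f p -> analytic_at (partial1 f) p.
Proof.
by move=> /analytic_atP[c [r fc]]; apply/analytic_atP; exists (dcoef1 c), r; exact: has_power_series_partial1.
Qed.

Lemma analytic_at_partial2 f p : analytic_at f p -> analytic_at (partial2 f) p.
Proof.
by move=> /analytic_atP[c [r fc]]; apply/analytic_atP; exists (dcoef2 c), r; exact: has_power_series_partial2.
Qed.

Lemma analytic_at_is_diff f p : analytic_at f p ->
  is_diff p (fun z => f z.1 z.2)
    (fun k => k.1 * partial1 f p.1 p.2 + k.2 * partial2 f p.1 p.2).
Proof. by move=> /analytic_atP[c [r]]; exact: has_power_series_is_diff_partial. Qed.

(** Both sides are the constant coefficient of a twice differentiated series, namely [c 1 1]. *)
Lemma partial12 f p : analytic_at f p ->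
  partial2 (partial1 f) p.1 p.2 = partial1 (partial2 f) p.1 p.2.
Proof.
move=> /analytic_atP[c [r fc]].
have f12 := has_power_series_partial2 (has_power_series_partial1 fc).
have f21 := has_power_series_partial1 (has_power_series_partial2 fc).
by rewrite (has_power_series_center f12) (has_power_series_center f21).
Qed.

End DoublePowerSeries.

(** * Smooth functions and symmetry of second derivatives *)

Section ChainRules.
Variables (R : realType) (V : normedModType R).
Implicit Types (g dg : V -> R) (x : V).

Lemma is_diff_comp1 (k : R -> R) (a : R) g dg x : is_derive (g x) 1 k a ->
  is_diff x g dg -> is_diff x (fun y => k (g y)) (fun h => dg h * a).
Proof.
move=> ka gdg; have kd : derivable k (g x) 1 by [].
have kD : is_diff (g x) k ( *:%R^~ a).
  split; first exact/derivable1_diffP.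
  by rewrite deriv1E// derive1E derive_val.
exact: is_diff_comp gdg kD.
Qed.

Lemma is_diff_comp2 (f : R -> R -> R) g1 dg1 g2 dg2 x :
  analytic_at f (g1 x, g2 x) -> is_diff x g1 dg1 -> is_diff x g2 dg2 ->
  is_diff x (fun y => f (g1 y) (g2 y))
    (fun h => dg1 h * partial1 f (g1 x) (g2 x) + dg2 h * partial2 f (g1 x) (g2 x)).
Proof.
move=> /analytic_at_is_diff/= fd d1 d2.
have gd : is_diff x (fun y => (g1 y, g2 y)) (fun h => (dg1 h, dg2 h)) by exact: is_diff_pair.
exact: (is_diff_comp gd fd).
Qed.

Lemma is_diff_derive g dg x v : is_diff x g dg -> 'D_v g x = dg v.
Proof. by move=> gd; rewrite deriveE// diff_val. Qed.

Lemma is_diff_is_derive g dg x v : is_diff x g dg -> is_derive x v g (dg v).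
Proof.
by move=> gd; split; [exact: diff_derivable|exact: is_diff_derive].
Qed.

End ChainRules.

(** * Directional derivatives and their commutation *)

Section Lines.
Variables (R : realType) (V : normedModType R).
Implicit Types (g : V -> R) (x : V).

Lemma is_derive_line g x u (t : R) : differentiable g (t *: u + x) ->
  is_derive t (1 : R) (fun s : R => g (s *: u + x)) ('D_u g (t *: u + x)).
Proof.
move=> gd.
have l : is_diff t (fun s : R => s *: u + x) ( *:%R^~ u).
  have l := is_diffD (is_diff_scalel t u) (is_diff_cst x t).
  by apply: is_diff_eq l _; rewrite addr0.
have gD := is_diff_comp l (differentiableP gd).
by have := is_diff_is_derive (1 : R) gD; rewrite /= scale1r -deriveE.
Qed.

Lemma is_deriveP_line g x v d :
  is_derive x v g d <-> is_derive (0 : R) (1 : R) (fun t => g (t *: v + x)) d.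
Proof.
have E : 'D_v g x = 'D_1 (fun t : R => g (t *: v + x)) (0 : R).
  rewrite /derive; set k1 := fun h => h^-1 *: _; set k2 := fun h => h^-1 *: _.
  suff -> : k1 = k2 by [].
  apply/funext => h; rewrite /k1 /k2 /=.
  by rewrite addr0 scale0r add0r [_%:A]mulr1.
split=> -[gx <-]; (split; last by rewrite E).
  - exact: (proj1 (derivable1P g x v) gx).
- exact: (proj2 (derivable1P g x v) gx).
Qed.

Lemma differentiable_littleo g x (e : R) : differentiable g x -> 0 < e ->
  exists2 d : R, 0 < d &
    forall k, `|k| < d -> `|g (k + x) - g x - 'd g x k| <= e * `|k|.
Proof.
move=> /diff_locally/eqaddoP gx e0.
have /nbhs_normP[d d0 H] := gx _ e0.
exists d => // k kd; have := H k; rewrite /= sub0r normrN => /(_ kd).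
by rewrite !fctE/= opprD addrA.
Qed.

(** The mean value theorem along u turns the second difference into h times a first difference of
    ['D_u g]; linearising that at x, the u increments cancel and only the v increment remains. *)
Lemma second_difference g x u v (e : R) : (forall y, differentiable g y) ->
  differentiable ('D_u g) x -> 0 < e ->
  exists2 d : R, 0 < d & forall h : R, 0 < h < d ->
    `|g (h *: u + h *: v + x) - g (h *: u + x) - g (h *: v + x) + g x
      - h ^+ 2 * 'D_v ('D_u g) x| <= e * h ^+ 2.
Proof.
(* All increments have norm at most h N, so two errors with slope e / (2 N) add up to e h; the 1
   keeps N positive when u = v = 0. *)
move=> gd gud e0; pose N := `|u| + `|v| + 1.
have N0 : 0 < N by rewrite ltr_wpDl// addr_ge0.
have e1 : 0 < e / (2 * N) by rewrite divr_gt0 ?mulr_gt0.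
have [d d0 H] := differentiable_littleo gud e1.
exists (d / N); first by rewrite divr_gt0.
move=> h /andP[h0]; rewrite ltr_pdivlMr// => hd.
pose psi (s : R) := g (s *: u + (h *: v + x)) - g (s *: u + x).
have psiD (s : R) : is_derive s (1 : R) psi ('D_u g (s *: u + (h *: v + x)) - 'D_u g (s *: u + x)).
  by apply: is_deriveB; exact: is_derive_line.
have [] := @MVT R psi (fun s => 'D_u g (s *: u + (h *: v + x)) - 'D_u g (s *: u + x)) 0 h h0.
  by apply: derivable_within_continuous => s _; have [] := psiD s.
move=> c; rewrite in_itv/= => /andP[c0 ch].
rewrite subr0 /psi !scale0r !add0r => E.
have -> : g (h *: u + h *: v + x) - g (h *: u + x) - g (h *: v + x) + g x =
   ('D_u g (c *: u + (h *: v + x)) - 'D_u g (c *: u + x)) * h.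
  by rewrite -E addrA; ring.
have k1 : `|c *: u + h *: v| <= h * N.
  apply: le_trans (ler_normD _ _) _; rewrite !normrZ (gtr0_norm c0) (gtr0_norm h0) /N !mulrDr.
  by rewrite -addrA lerD ?ler_wpM2r ?(ltW ch)// mulr1 lerDl ltW.
have k2 : `|c *: u| <= h * N.
  rewrite normrZ (gtr0_norm c0) /N !mulrDr mulr1 -addrA ler_wpDr//.
    by rewrite addr_ge0 ?mulr_ge0 ?(ltW h0).
  by rewrite ler_wpM2r ?(ltW ch).
have H1 := le_trans (H _ (le_lt_trans k1 hd)) (ler_wpM2l (ltW e1) k1).
have H2 := le_trans (H _ (le_lt_trans k2 hd)) (ler_wpM2l (ltW e1) k2).
have Dv : 'D_v ('D_u g) x = 'd ('D_u g) x v by rewrite deriveE.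
have L1 : 'd ('D_u g) x (c *: u + h *: v) = c * 'd ('D_u g) x u + h * 'd ('D_u g) x v.
  by rewrite linearD !linearZ.
have L2 : 'd ('D_u g) x (c *: u) = c * 'd ('D_u g) x u by rewrite linearZ.
rewrite L1 -(addrA _ _ x) in H1; rewrite L2 in H2; rewrite Dv.
move: ('D_u g (c *: u + (h *: v + x))) ('D_u g (c *: u + x)) ('D_u g x)
  ('d ('D_u g) x v) ('d ('D_u g) x u) H1 H2 => P1 P2 P A B H1 H2.
have -> : (P1 - P2) * h - h ^+ 2 * A =
   h * ((P1 - P - (c * B + h * A)) - (P2 - P - c * B)) by ring.
rewrite normrM (gtr0_norm h0).
apply: (@le_trans _ _ (h * (e / (2 * N) * (h * N) + e / (2 * N) * (h * N)))).
  rewrite ler_wpM2l ?(ltW h0)//.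
  by apply: le_trans (ler_normB _ _) _; rewrite lerD.
rewrite le_eqVlt; apply/orP; left; apply/eqP; field.
by rewrite gt_eqF.
Qed.

(** The second difference is symmetric in u and v, so h^2 times either mixed derivative is within e
    h^2 / 2 of the same number. *)
Theorem derive_comm g x u v : (forall y, differentiable g y) ->
  differentiable ('D_u g) x -> differentiable ('D_v g) x ->
  'D_v ('D_u g) x = 'D_u ('D_v g) x.
Proof.
move=> gd gu gv; apply/eqP; rewrite -subr_eq0 -normr_le0; apply/ler_addgt0Pl => e e0.
have e2 : 0 < e / 2 by rewrite divr_gt0.
have [d1 d10 H1] := second_difference v gd gu e2.
have [d2 d20 H2] := second_difference u gd gv e2.
pose h := Num.min d1 d2 / 2.
have m0 : 0 < Num.min d1 d2 by rewrite lt_min d10.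
have h0 : 0 < h by rewrite divr_gt0.
have hm : h < Num.min d1 d2 by rewrite ltr_pdivrMr// ltr_pMr// ltr1n.
move: hm; rewrite lt_min => /andP[hd1 hd2].
have {}H1 := H1 h; rewrite h0 in H1; have {}H1 := H1 hd1.
have {}H2 := H2 h; rewrite h0 in H2; have {}H2 := H2 hd2.
rewrite [h *: v + h *: u]addrC in H2.
move: H1 H2; set G := g (_ + _ + x); move: ('D_v ('D_u g) x) ('D_u ('D_v g) x) => A B H1 H2.
rewrite addr0 -(ler_pM2r (_ : 0 < h ^+ 2)) ?exprn_gt0//.
rewrite -[h ^+ 2 in leLHS](ger0_norm (sqr_ge0 h)) -normrM.
have -> : (A - B) * h ^+ 2 =
  (G - g (h *: v + x) - g (h *: u + x) + g x - h ^+ 2 * B)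
  - (G - g (h *: u + x) - g (h *: v + x) + g x - h ^+ 2 * A) by ring.
apply: le_trans (ler_normB _ _) _.
by apply: le_trans (lerD H2 H1) _; rewrite -mulrDl -splitr.
Qed.

End Lines.

(** * Closure properties of smooth functions *)

Section Smooth.
Variable R : realType.
Local Notation rV4 := 'rV[R]_4.
Implicit Types (g : rV4 -> R).

(* Unlike [pds], this recursion exposes the derivative taken first, as needed for
   the Leibniz and chain rules. *)
Fixpoint ck (n : nat) (g : rV4 -> R) : Prop :=
  (forall x, differentiable g x) /\
  if n is n'.+1 then forall m, ck n' (pd m g) else True.

Lemma ck_differentiable n g x : ck n g -> differentiable g x.
Proof. by case: n => [|n] []. Qed.

Lemma ckS n g : ck n.+1 g <-> (forall x, differentiable g x) /\ forall m, ck n (pd m g).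
Proof. by []. Qed.

Lemma ckW n g : ck n.+1 g -> ck n g.
Proof. by elim: n g => [|n IH] g [gd gn]; split=> // m; apply: IH; exact: gn. Qed.

Lemma smooth_pd m g : smooth g -> smooth (pd m g).
Proof. by move=> gs s x; have := gs (rcons s m) x; rewrite /pds foldr_rcons. Qed.

Lemma smoothP g : smooth g <-> forall n, ck n g.
Proof.
split=> [+ n|].
  elim: n g => [|n IH] g gs; first by split=> // x; exact: (gs [::]).
  by split=> [x|m]; [exact: (gs [::])|apply: IH; exact: smooth_pd].
move=> + s; move: s g; elim/last_ind => [|s m IH] g gs x.
  exact: ck_differentiable (gs 0%N).
by rewrite /pds foldr_rcons; apply: IH => n; have /ckS[_] := gs n.+1.
Qed.

Lemma smooth_differentiable g x : smooth g -> differentiable g x.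
Proof. by move=> gs; exact: (gs [::]). Qed.

Lemma is_diff_pd m g dg x : is_diff x g dg -> pd m g x = dg (delta_mx 0 m).
Proof. exact: is_diff_derive. Qed.

Lemma pdD m g h x : differentiable g x -> differentiable h x ->
  pd m (fun y => g y + h y) x = pd m g x + pd m h x.
Proof.
move=> /differentiableP gd /differentiableP hd.
by rewrite (is_diff_pd _ (is_diffD gd hd)) !fctE -(is_diff_pd _ gd) -(is_diff_pd _ hd).
Qed.

Lemma pdM m g h x : differentiable g x -> differentiable h x ->
  pd m (fun y => g y * h y) x = pd m g x * h x + g x * pd m h x.
Proof.
move=> /differentiableP gd /differentiableP hd.
rewrite (is_diff_pd _ (is_diffM gd hd)) !fctE (is_diff_pd m gd) (is_diff_pd m hd).
by rewrite [RHS]addrC; congr (_ + _); exact: mulrC.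
Qed.

Lemma pd_cst m (a : R) x : pd m (fun=> a) x = 0.
Proof. by rewrite (is_diff_pd _ (is_diff_cst a x)). Qed.

Lemma pd_sum n m (g : 'I_n -> rV4 -> R) x : (forall i, differentiable (g i) x) ->
  pd m (fun y => \sum_(i < n) g i y) x = \sum_(i < n) pd m (g i) x.
Proof.
move=> gd; rewrite /pd -derive_sum//; last by move=> i; exact: diff_derivable.
by congr ('D__ _ _); apply/funext => y; rewrite fct_sumE.
Qed.

Lemma ck_cst n (a : R) : ck n (fun=> a).
Proof.
elim: n a => [|n IH] a; split=> // x.
have -> : pd x (fun=> a) = (fun=> 0) by apply/funext => y; exact: pd_cst.
exact: IH.
Qed.

Lemma ckD n g h : ck n g -> ck n h -> ck n (fun y => g y + h y).
Proof.
elim: n g h => [|n IH] g h.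
  by move=> [gd _] [hd _]; split=> // x; exact: differentiableD.
move=> /ckS[gd gn] /ckS[hd hn].
split=> [x|m]; first exact: differentiableD.
have -> : pd m (fun y => g y + h y) = (fun y => pd m g y + pd m h y).
  by apply/funext => y; exact: pdD.
exact: IH.
Qed.

Lemma ckM n g h : ck n g -> ck n h -> ck n (fun y => g y * h y).
Proof.
elim: n g h => [|n IH] g h gn hn.
  by case: gn hn => gd _ [hd _]; split=> // x; exact: differentiableM.
move: (gn) (hn) => /ckS[gd gn'] /ckS[hd hn'].
split=> [x|m]; first exact: differentiableM.
have -> : pd m (fun y => g y * h y) = (fun y => pd m g y * h y + g y * pd m h y).
  by apply/funext => y; exact: pdM.
by apply: ckD; apply: IH => //; exact: ckW.
Qed.

(** The induction runs over all [f] at once: the chain rule brings in [partial1 f] and [partial2 f],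
    which are again analytic on [U]. *)
Lemma ck_comp2 n (U : set (R * R)) (f : R -> R -> R) g1 g2 :
  (forall z, U z -> analytic_at f z) -> (forall x, U (g1 x, g2 x)) ->
  ck n g1 -> ck n g2 -> ck n (fun y => f (g1 y) (g2 y)).
Proof.
move=> fU gU; elim: n f fU => [|n IH] f fU.
all: have fd x (d1 : differentiable g1 x) (d2 : differentiable g2 x) :=
  is_diff_comp2 (fU _ (gU x)) (differentiableP d1) (differentiableP d2).
  by move=> [d1 _] [d2 _]; split=> // x; have [] := fd x (d1 x) (d2 x).
move=> c1 c2; move: (c1) (c2) => /ckS[d1 c1'] /ckS[d2 c2'].
split=> [x|m]; first by have [] := fd x (d1 x) (d2 x).
have -> : pd m (fun y => f (g1 y) (g2 y)) = (fun y => pd m g1 y * partial1 f (g1 y) (g2 y)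
    + pd m g2 y * partial2 f (g1 y) (g2 y)).
  apply/funext => y; rewrite (is_diff_pd _ (fd y (d1 y) (d2 y))).
  by rewrite -(is_diff_pd _ (differentiableP (d1 y))) -(is_diff_pd _ (differentiableP (d2 y))).
apply: ckD; apply: ckM => //.
- by apply: IH (ckW c1) (ckW c2) => z Uz; exact/analytic_at_partial1/fU.
- by apply: IH (ckW c1) (ckW c2) => z Uz; exact/analytic_at_partial2/fU.
Qed.

Lemma is_derive_invsqrt (t : R) : 0 < t ->
  is_derive t 1 (fun s => (Num.sqrt s)^-1) (- 2^-1 * (Num.sqrt t)^-1 ^+ 3).
Proof.
move=> t0; have s0 : Num.sqrt t != 0 by rewrite gt_eqF// sqrtr_gt0.
have D := is_derive1_sqrt t0.
apply: is_derive_eq (is_deriveV s0 D) _.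
by rewrite /GRing.scale/=; field.
Qed.

(** The derivative of g^(-1/2) is -1/2 times g' times the cube of g^(-1/2) itself, so the induction
    needs nothing beyond products. *)
Lemma ck_invsqrt n g : (forall x, 0 < g x) -> ck n g -> ck n (fun y => (Num.sqrt (g y))^-1).
Proof.
move=> g0; have gD x (gd : differentiable g x) :=
  is_diff_comp1 (is_derive_invsqrt (g0 x)) (differentiableP gd).
elim: n => [|n IH].
  by move=> [gd _]; split=> // x; have [] := gD x (gd x).
move=> c; move: (c) => /ckS[gd gn]; split=> [x|m]; first by have [] := gD x (gd x).
have -> : pd m (fun y => (Num.sqrt (g y))^-1) =
  (fun y => pd m g y * (- 2^-1 * ((Num.sqrt (g y))^-1 * ((Num.sqrt (g y))^-1 * (Num.sqrt (g y))^-1)))).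
  apply/funext => y; rewrite (is_diff_pd _ (gD y (gd y))).
  by rewrite -(is_diff_pd _ (differentiableP (gd y))) !exprS expr0 mulr1.
have C := IH (ckW c).
by apply: ckM => //; apply: ckM; [exact: ck_cst|]; do 2!apply: ckM => //.
Qed.

Lemma smooth_cst (a : R) : smooth (fun=> a).
Proof. by apply/smoothP => n; exact: ck_cst. Qed.

Lemma smoothD g h : smooth g -> smooth h -> smooth (fun y => g y + h y).
Proof. by move=> /smoothP gs /smoothP hs; apply/smoothP => n; exact: ckD. Qed.

Lemma smoothM g h : smooth g -> smooth h -> smooth (fun y => g y * h y).
Proof. by move=> /smoothP gs /smoothP hs; apply/smoothP => n; exact: ckM. Qed.

Lemma smoothN g : smooth g -> smooth (fun y => - g y).
Proof.
move=> gs; have -> : (fun y => - g y) = (fun y => (-1) * g y) by apply/funext => y; rewrite mulN1r.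
by apply: smoothM => //; exact: smooth_cst.
Qed.

Lemma smoothB g h : smooth g -> smooth h -> smooth (fun y => g y - h y).
Proof. by move=> gs /smoothN hs; exact: smoothD. Qed.

Lemma smooth_sum n (g : 'I_n -> rV4 -> R) : (forall i, smooth (g i)) ->
  smooth (fun y => \sum_(i < n) g i y).
Proof.
elim: n g => [|n IH] g gs.
  by under eq_fun do rewrite big_ord0; exact: smooth_cst.
by under eq_fun do rewrite big_ord_recl; apply: smoothD => //; exact: IH.
Qed.

Lemma smooth_comp2 (U : set (R * R)) (f : R -> R -> R) g1 g2 :
  (forall z, U z -> analytic_at f z) -> (forall x, U (g1 x, g2 x)) ->
  smooth g1 -> smooth g2 -> smooth (fun y => f (g1 y) (g2 y)).
Proof. by move=> fU gU /smoothP s1 /smoothP s2; apply/smoothP => n; exact: ck_comp2 fU gU _ _. Qed.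

Lemma smooth_invsqrt g : (forall x, 0 < g x) -> smooth g ->
  smooth (fun y => (Num.sqrt (g y))^-1).
Proof. by move=> g0 /smoothP gs; apply/smoothP => n; exact: ck_invsqrt. Qed.

Lemma pd_comm m n g x : smooth g -> pd m (pd n g) x = pd n (pd m g) x.
Proof.
move=> gs; apply: derive_comm => [y| |]; apply: smooth_differentiable => //; exact: smooth_pd.
Qed.

End Smooth.

(** * Tensor algebra at a point *)

(** A table of the 24 permutations, so that entries of the symbol evaluate by reduction; [Negz 0] is
    -1. *)
Definition levz (m n p q : nat) : int :=
  match m, n, p, q with
  | 0, 1, 2, 3 | 0, 2, 3, 1 | 0, 3, 1, 2 | 1, 0, 3, 2 | 1, 2, 0, 3 | 1, 3, 2, 0
  | 2, 0, 1, 3 | 2, 1, 3, 0 | 2, 3, 0, 1 | 3, 0, 2, 1 | 3, 1, 0, 2 | 3, 2, 1, 0 => Posz 1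
  | 0, 1, 3, 2 | 0, 2, 1, 3 | 0, 3, 2, 1 | 1, 0, 2, 3 | 1, 2, 3, 0 | 1, 3, 0, 2
  | 2, 0, 3, 1 | 2, 1, 0, 3 | 2, 3, 1, 0 | 3, 0, 1, 2 | 3, 1, 2, 0 | 3, 2, 0, 1 => Negz 0
  | _, _, _, _ => Posz 0
  end%N.

Local Notation o0 := (@Ordinal 4 0 isT).
Local Notation o1 := (@Ordinal 4 1 isT).
Local Notation o2 := (@Ordinal 4 2 isT).
Local Notation o3 := (@Ordinal 4 3 isT).

Section Algebra.
Variable R : realType.
Local Notation vect := ('I_4 -> R).
Local Notation tens := ('I_4 -> 'I_4 -> R).

Lemma levi_civitaE (m n p q : 'I_4) : levi_civita m n p q = (levz m n p q)%:~R :> R.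
Proof.
pose s (i j : nat) : int := Num.sg (j%:Z - i%:Z).
have sE (i j : nat) : Num.sg (j%:R - i%:R : R) = (s i j)%:~R.
  rewrite /s; case: (ltngtP i j) => [ij|ji|->]; last by rewrite !subrr !sgr0.
  - by rewrite !gtr0_sg// subr_gt0 ?ltr_nat// ltz_nat.
  - by rewrite !ltr0_sg ?mulrN1z// subr_lt0 ?ltr_nat// ltz_nat.
rewrite /levi_civita !sE -!intrM; congr (_%:~R).
by case: m n p q => [[|[|[|[|m]]]] Hm] [[|[|[|[|n]]]] Hn] [[|[|[|[|p]]]] Hp] [[|[|[|[|q]]]] Hq].
Qed.

Lemma sum4E (V : nmodType) (g : 'I_4 -> V) : \sum_(i < 4) g i = g o0 + g o1 + g o2 + g o3.
Proof.
rewrite !big_ord_recl big_ord0 addr0 !addrA.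
by congr (g _ + g _ + g _ + g _); apply: val_inj.
Qed.

Lemma metric0 : metric o0 = -1 :> R. Proof. by []. Qed.
Lemma metric1 : metric o1 = 1 :> R. Proof. by []. Qed.
Lemma metric2 : metric o2 = 1 :> R. Proof. by []. Qed.
Lemma metric3 : metric o3 = 1 :> R. Proof. by []. Qed.
Definition metricE := (metric0, metric1, metric2, metric3).

Lemma levi_sumE (T : 'I_4 -> 'I_4 -> 'I_4 -> 'I_4 -> R) :
  \sum_(m < 4) \sum_(n < 4) \sum_(p < 4) \sum_(q < 4) levi_civita m n p q * T m n p q =
  T o0 o1 o2 o3 + T o0 o2 o3 o1 + T o0 o3 o1 o2 + T o1 o0 o3 o2 + T o1 o2 o0 o3 + T o1 o3 o2 o0
  + T o2 o0 o1 o3 + T o2 o1 o3 o0 + T o2 o3 o0 o1 + T o3 o0 o2 o1 + T o3 o1 o0 o2 + T o3 o2 o1 o0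
  - (T o0 o1 o3 o2 + T o0 o2 o1 o3 + T o0 o3 o2 o1 + T o1 o0 o2 o3 + T o1 o2 o3 o0 + T o1 o3 o0 o2
  + T o2 o0 o3 o1 + T o2 o1 o0 o3 + T o2 o3 o1 o0 + T o3 o0 o1 o2 + T o3 o1 o2 o0 + T o3 o2 o0 o1).
Proof.
(* Treating each value of the first index separately keeps every expansion at 64 terms, of which 6
   survive. *)
have row (m : 'I_4) (U : 'I_4 -> 'I_4 -> 'I_4 -> R) :
    \sum_(n < 4) \sum_(p < 4) \sum_(q < 4) levi_civita m n p q * U n p q =
    \sum_(n < 4) \sum_(p < 4) ((levz m n p 0)%:~R * U n p o0 + (levz m n p 1)%:~R * U n p o1
      + (levz m n p 2)%:~R * U n p o2 + (levz m n p 3)%:~R * U n p o3).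
  by apply: eq_bigr => n _; apply: eq_bigr => p _; rewrite sum4E !levi_civitaE.
rewrite sum4E !row; set a := (X in X + _ + _ + _); set b := (X in _ + X + _ + _).
set c := (X in _ + _ + X + _); set d := (X in _ + _ + _ + X).
have -> : a = T o0 o1 o2 o3 + T o0 o2 o3 o1 + T o0 o3 o1 o2
    - (T o0 o1 o3 o2 + T o0 o2 o1 o3 + T o0 o3 o2 o1).
  by rewrite /a !sum4E /= !mul0r !addr0 !add0r; ring.
have -> : b = T o1 o0 o3 o2 + T o1 o2 o0 o3 + T o1 o3 o2 o0
    - (T o1 o0 o2 o3 + T o1 o2 o3 o0 + T o1 o3 o0 o2).
  by rewrite /b !sum4E /= !mul0r !addr0 !add0r; ring.
have -> : c = T o2 o0 o1 o3 + T o2 o1 o3 o0 + T o2 o3 o0 o1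
    - (T o2 o0 o3 o1 + T o2 o1 o0 o3 + T o2 o3 o1 o0).
  by rewrite /c !sum4E /= !mul0r !addr0 !add0r; ring.
have -> : d = T o3 o0 o2 o1 + T o3 o1 o0 o2 + T o3 o2 o1 o0
    - (T o3 o0 o1 o2 + T o3 o1 o2 o0 + T o3 o2 o0 o1).
  by rewrite /d !sum4E /= !mul0r !addr0 !add0r; ring.
ring.
Qed.

Definition dot (a b : vect) : R := \sum_(m < 4) metric m * a m * b m.
Definition tcontract (w : vect) (T : tens) : vect := fun m => \sum_(n < 4) metric n * w n * T n m.
Definition hodge (T : tens) : tens := fun m n =>
  2^-1 * \sum_(p < 4) \sum_(q < 4) levi_civita m n p q * (metric p * metric q * T p q).
(** The lower components are contracted without metric factors. As the metric has determinant -1,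
    this is minus the contraction with $\epsilon^{mnpq}$. *)
Definition vol (a b c d : vect) : R :=
  \sum_(m < 4) \sum_(n < 4) \sum_(p < 4) \sum_(q < 4)
    levi_civita m n p q * (a m * b n * c p * d q).
Definition antisym (T : tens) := forall m n, T m n = - T n m.

Lemma antisym_diag T m : antisym T -> T m m = 0.
Proof. by move=> /(_ m m) TN; lra. Qed.

Lemma antisymE T : antisym T -> ((T o0 o0 = 0) * (T o1 o1 = 0) * (T o2 o2 = 0) * (T o3 o3 = 0) *
  (T o1 o0 = - T o0 o1) * (T o2 o0 = - T o0 o2) * (T o3 o0 = - T o0 o3) *
  (T o2 o1 = - T o1 o2) * (T o3 o1 = - T o1 o3) * (T o3 o2 = - T o2 o3))%type.
Proof. by move=> TN; rewrite !antisym_diag//; do !split => //; exact: TN. Qed.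

Lemma hodgeE T : antisym T ->
  ((hodge T o0 o1 = T o2 o3) * (hodge T o0 o2 = - T o1 o3) * (hodge T o0 o3 = T o1 o2) *
   (hodge T o1 o2 = - T o0 o3) * (hodge T o1 o3 = T o0 o2) * (hodge T o2 o3 = - T o0 o1))%type.
Proof.
move=> TN; rewrite /hodge; do !split.
all: by rewrite !sum4E !levi_civitaE !metricE !(antisymE TN) /=; field.
Qed.

Lemma levi_civitaC12 m n p q : levi_civita m n p q = - levi_civita n m p q :> R.
Proof.
rewrite !levi_civitaE -mulrNz; congr (_%:~R).
by case: m n p q => [[|[|[|[|m]]]] Hm] [[|[|[|[|n]]]] Hn] [[|[|[|[|p]]]] Hp] [[|[|[|[|q]]]] Hq].
Qed.

Lemma hodge_antisym T : antisym (hodge T).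
Proof.
move=> m n; rewrite /hodge -mulrN -sumrN; congr (_ * _); apply: eq_bigr => p _.
by rewrite -sumrN; apply: eq_bigr => q _; rewrite levi_civitaC12 mulNr.
Qed.

(** In Lorentzian signature the Hodge star squares to -1 on two-forms. *)
Lemma tcontract_hodge2 w T m : antisym T -> tcontract w (hodge (hodge T)) m = - tcontract w T m.
Proof.
move=> TN; have HN := hodge_antisym T; have HHN := hodge_antisym (hodge T).
rewrite /tcontract !sum4E.
case: m => [[|[|[|[|m]]]] Hm]//; rewrite (bool_irrelevance Hm isT).
all: rewrite ?(antisymE HHN) ?(hodgeE HN) ?(antisymE HN) ?(hodgeE TN) ?(antisymE TN); ring.
Qed.

Lemma vect4P (a b : vect) : (forall c, dot a c = dot b c) -> a =1 b.
Proof.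
move=> ab m; have := ab (fun n => metric m * (n == m)%:R).
rewrite /dot (bigD1 m)//= [X in _ = X -> _](bigD1 m)//= eqxx !big1 ?addr0; first last.
- by move=> i /negbTE ->; rewrite !mulr0.
- by move=> i /negbTE ->; rewrite !mulr0.
have mm : metric m * metric m = 1 :> R by rewrite /metric; case: ifP => _; ring.
by rewrite !mulr1 ![metric m * _ * metric m]mulrAC mm !mul1r.
Qed.

(** Only products of an electric and a magnetic part survive: two electric parts share the factor v,
    and two magnetic parts live in the three-space orthogonal to v. *)
Lemma levi_wedge v T1 T2 : antisym T1 -> antisym T2 -> dot v v = -1 ->
  \sum_(m < 4) \sum_(n < 4) \sum_(p < 4) \sum_(q < 4) levi_civita m n p q * (T1 m n * T2 p q) =
  4 * (dot (tcontract v T1) (tcontract v (hodge T2)) + dot (tcontract v (hodge T1)) (tcontract v T2)).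
Proof.
move=> T1N T2N vv; have H1N := hodge_antisym T1; have H2N := hodge_antisym T2.
(* The factor - v.v = 1 makes both sides quadratic in v, so that the claim is a polynomial identity
   in the components. *)
rewrite levi_sumE; set L := LHS; have -> : L = - dot v v * L by rewrite vv opprK mul1r.
rewrite {}/L.
rewrite /dot /tcontract !sum4E !metricE !(antisymE H1N) !(antisymE H2N) !(hodgeE T1N) !(hodgeE T2N).
rewrite !(antisymE T1N) !(antisymE T2N).
move: (T1 o0 o1) (T1 o0 o2) (T1 o0 o3) (T1 o1 o2) (T1 o1 o3) (T1 o2 o3).
move: (T2 o0 o1) (T2 o0 o2) (T2 o0 o3) (T2 o1 o2) (T2 o1 o3) (T2 o2 o3).
move: (v o0) (v o1) (v o2) (v o3) => *; ring.
Qed.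

(** This is the decomposition of T along v: the magnetic part contributes the volume, the electric
    part the two products of dots. *)
Lemma dot_tcontract v k T Y : antisym T -> dot v v = -1 ->
  dot (tcontract k T) Y =
  vol v k (tcontract v (hodge T)) Y - dot k v * dot (tcontract v T) Y
    + dot k (tcontract v T) * dot v Y.
Proof.
move=> TN vv; have HN := hodge_antisym T.
set L := LHS; have -> : L = - dot v v * L by rewrite vv opprK mul1r.
rewrite {}/L.
rewrite /vol levi_sumE /dot /tcontract !sum4E !metricE !(antisymE HN) !(hodgeE TN) !(antisymE TN).
move: (T o0 o1) (T o0 o2) (T o0 o3) (T o1 o2) (T o1 o3) (T o2 o3).
move: (v o0) (v o1) (v o2) (v o3) (k o0) (k o1) (k o2) (k o3) (Y o0) (Y o1) (Y o2) (Y o3).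
move=> *; ring.
Qed.

Lemma eq_dot a a' b b' : a =1 a' -> b =1 b' -> dot a b = dot a' b'.
Proof. by move=> aa bb; apply: eq_bigr => m _; rewrite aa bb. Qed.

Lemma eq_vol a a' b b' c c' d d' : a =1 a' -> b =1 b' -> c =1 c' -> d =1 d' ->
  vol a b c d = vol a' b' c' d'.
Proof.
by move=> aa bb cc dd; do 4!apply: eq_bigr => ? _; rewrite aa bb cc dd.
Qed.

Lemma dotC a b : dot a b = dot b a.
Proof. by apply: eq_bigr => m _; rewrite -!mulrA [a m * _]mulrC. Qed.

Lemma dotNl a b : dot (fun m => - a m) b = - dot a b.
Proof. by rewrite /dot -sumrN; apply: eq_bigr => m _; rewrite mulrN mulNr. Qed.

Lemma volN3 a b c d : vol a b (fun m => - c m) d = - vol a b c d.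
Proof. by rewrite /vol !levi_sumE; ring. Qed.

Lemma volC a b c d : vol a b d c = - vol a b c d.
Proof. by rewrite /vol !levi_sumE; ring. Qed.

Lemma dot_tcontract_hodge v k T Y : antisym T -> dot v v = -1 ->
  dot (tcontract k (hodge T)) Y =
  - vol v k (tcontract v T) Y - dot k v * dot (tcontract v (hodge T)) Y
    + dot k (tcontract v (hodge T)) * dot v Y.
Proof.
move=> TN vv; rewrite (dot_tcontract _ _ (hodge_antisym T) vv).
rewrite (@eq_vol v v k k _ (fun m => - tcontract v T m) Y Y)// => [|m]; first by rewrite volN3.
exact: tcontract_hodge2.
Qed.

Lemma dot_tcontract_self v T : antisym T -> dot v (tcontract v T) = 0.
Proof.
by move=> TN; rewrite /dot /tcontract !sum4E !metricE !(antisymE TN); ring.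
Qed.

(** Antisymmetrising P gives a 2 that cancels the 1/2 of [hodge]; the sign is the determinant of the
    metric, from raising all indices. *)
Lemma tcontract_hodge_curl v (P : tens) Y :
  dot (tcontract v (hodge (fun m n => P m n - P n m))) Y =
  - \sum_(m < 4) \sum_(n < 4) \sum_(p < 4) \sum_(q < 4)
      levi_civita m n p q * (v m * P n p * Y q).
Proof.
pose T : tens := fun m n => P m n - P n m.
have TN : antisym T by move=> m n; rewrite /T opprB.
have HN := hodge_antisym T.
rewrite levi_sumE /dot /tcontract !sum4E !metricE !(antisymE HN) !(hodgeE TN) /T; ring.
Qed.

(** Four slots fit the linearised currents, combinations of B1, B2 and their variations; shorter
    combinations are padded with zero coefficients. *)
Definition comb (a b c d : R) (x y z w : vect) : vect :=
  fun m => a * x m + b * y m + c * z m + d * w m.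

Lemma dot_combl a b c d x y z w t : dot (comb a b c d x y z w) t =
  a * dot x t + b * dot y t + c * dot z t + d * dot w t.
Proof.
by rewrite /dot !mulr_sumr -!big_split; apply: eq_bigr => m _; rewrite /comb/=; ring.
Qed.

Lemma vol_comb4 v k s a b c d x y z w : vol v k s (comb a b c d x y z w) =
  a * vol v k s x + b * vol v k s y + c * vol v k s z + d * vol v k s w.
Proof. by rewrite /vol !levi_sumE /comb; ring. Qed.

Lemma vol_comb3 v k s a b c d x y z w : vol v k (comb a b c d x y z w) s =
  a * vol v k x s + b * vol v k y s + c * vol v k z s + d * vol v k w s.
Proof. by rewrite volC vol_comb4 !(volC v k _ s); ring. Qed.

Lemma vol_alt v k s : vol v k s s = 0.
Proof. by have := volC v k s s; lra. Qed.

Lemma vol_linear_rel v k k' (b c : vect) s : (forall m, k' m = k m / s + v m * dot v k / s) ->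
  vol v k' b c = vol v k b c / s.
Proof. by move=> kE; rewrite /vol !levi_sumE !kE; ring. Qed.

(** Here k is the variation of a covector of constant square, hence orthogonal to it. *)
Lemma dot_linear_rel v k w s : dot v v = -1 ->
  (forall m, k m = w m / s + v m * dot v w / s) -> dot k v = 0.
Proof.
move=> vv kE; have -> : dot k v = dot w v / s + dot v v * dot v w / s.
  by rewrite /dot !sum4E !metricE !kE /dot !sum4E !metricE; ring.
by rewrite vv (dotC w v); ring.
Qed.

(** * The currents J and their linearisation *)

Section SelfInteraction.
Variables (v B1 B2 : vect).
Hypotheses (vB1 : dot v B1 = 0) (vB2 : dot v B2 = 0).
Variables (f1 f2 : R).
Let G11 := dot B1 B1.
Let G12 := dot B1 B2.
Let G22 := dot B2 B2.

Definition curJ1 : vect := comb (f1 + f2 * G11) (f2 * G12) 0 0 B1 B2 B1 B2.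
Definition curJ2 : vect := comb (f2 * G12) (f1 + f2 * G22) 0 0 B1 B2 B1 B2.

(* [z1' = tr G / 2] and [z2' = tr (G ^ 2) / 4] for the Gram matrix [G] of [B1], [B2]. *)
Let z1' := 2^-1 * (G11 + G22).
Let z2' := 4^-1 * (G11 * G11 + G12 * G12 + (G12 * G12 + G22 * G22)).

Lemma vol_curJ k : vol v k curJ1 curJ2 =
  (f1 ^+ 2 + 2 * z1' * f1 * f2 + 2 * (z1' ^+ 2 - z2') * f2 ^+ 2) * vol v k B1 B2.
Proof.
rewrite /curJ1 /curJ2 vol_comb3 !vol_comb4 !vol_alt (volC v k B1 B2) /z1' /z2'; by field.
Qed.

Variables (f11 f12 f22 : R).
Hypothesis dQ1 : 2 * f1 * f11 + 2 * f1 * f2 + 2 * z1' * (f11 * f2 + f1 * f12)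
  + 4 * z1' * f2 ^+ 2 + 4 * (z1' ^+ 2 - z2') * f2 * f12 = 0.
Hypothesis dQ2 : 2 * f1 * f12 + 2 * z1' * (f12 * f2 + f1 * f22) - 2 * f2 ^+ 2
  + 4 * (z1' ^+ 2 - z2') * f2 * f22 = 0.
Hypothesis Q : f1 ^+ 2 + 2 * z1' * f1 * f2 + 2 * (z1' ^+ 2 - z2') * f2 ^+ 2 = 1.

Let dz1 (X1 X2 : vect) := dot B1 X1 + dot B2 X2.
Let dz2 (X1 X2 : vect) := G11 * dot B1 X1 + G12 * (dot B2 X1 + dot B1 X2) + G22 * dot B2 X2.
Let df1 X1 X2 := f11 * dz1 X1 X2 + f12 * dz2 X1 X2.
Let df2 X1 X2 := f12 * dz1 X1 X2 + f22 * dz2 X1 X2.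

(** The linearisation of [curJ1] when B1, B2 vary by X1, X2; [df1] and [df2] are the induced
    variations of f1 and f2. *)
Definition dJ1 (X1 X2 : vect) : vect :=
  comb (df1 X1 X2 + df2 X1 X2 * G11 + f2 * (2 * dot B1 X1))
       (df2 X1 X2 * G12 + f2 * (dot B2 X1 + dot B1 X2)) (f1 + f2 * G11) (f2 * G12) B1 B2 X1 X2.
Definition dJ2 (X1 X2 : vect) : vect :=
  comb (df2 X1 X2 * G12 + f2 * (dot B2 X1 + dot B1 X2))
       (df1 X1 X2 + df2 X1 X2 * G22 + f2 * (2 * dot B2 X2)) (f2 * G12) (f1 + f2 * G22) B1 B2 X1 X2.

(** The linearisation of J is the Hessian of [f (z1 h) (z2 h)]. Equality of the mixed derivatives is
    built in, as the same [f12] occurs in [df1] and [df2]. *)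
Lemma dJ_symmetric X1 X2 Y1 Y2 :
  dot (dJ1 X1 X2) Y1 + dot (dJ2 X1 X2) Y2 = dot (dJ1 Y1 Y2) X1 + dot (dJ2 Y1 Y2) X2.
Proof.
rewrite /dJ1 /dJ2 !dot_combl /df1 /df2 /dz1 /dz2 (dotC Y1 X1) (dotC Y1 X2) (dotC Y2 X1) (dotC Y2 X2).
ring.
Qed.

(** This is [vol_curJ] differentiated: the terms containing X1 or X2 in the volume carry the factor
    Q = 1, and those in [vol v k B1 B2] carry the differential of Q, which vanishes. *)
Lemma vol_dJ k X1 X2 : vol v k (dJ1 X1 X2) curJ2 + vol v k curJ1 (dJ2 X1 X2) =
  vol v k X1 B2 + vol v k B1 X2.
Proof.
rewrite -[RHS]mul1r -Q /curJ1 /curJ2 /dJ1 /dJ2 !vol_comb3 !vol_comb4 !vol_alt.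
rewrite (volC v k B1 B2) (volC v k X1 B2) (volC v k X1 B1) (volC v k X2 B2)  (volC v k X2 B1).
set x1 := dot B1 X1; set x2 := dot B2 X2; set x12 := dot B2 X1 + dot B1 X2.
apply/eqP; rewrite -subr_eq0; apply/eqP.
transitivity (vol v k B1 B2 * (
  (2 * f1 * f11 + 2 * f1 * f2 + 2 * z1' * (f11 * f2 + f1 * f12)
  + 4 * z1' * f2 ^+ 2 + 4 * (z1' ^+ 2 - z2') * f2 * f12) * dz1 X1 X2 +
  (2 * f1 * f12 + 2 * z1' * (f12 * f2 + f1 * f22) - 2 * f2 ^+ 2
  + 4 * (z1' ^+ 2 - z2') * f2 * f22) * dz2 X1 X2)).
  rewrite /df1 /df2 /dz1 /dz2 -/x1 -/x2 -/x12 /z1' /z2'; by field.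
by rewrite dQ1 dQ2; ring.
Qed.

Lemma dot_v_curJ1 : dot v curJ1 = 0.
Proof. by rewrite dotC dot_combl (dotC B1) (dotC B2) vB1 vB2; ring. Qed.

Lemma dot_v_curJ2 : dot v curJ2 = 0.
Proof. by rewrite dotC dot_combl (dotC B1) (dotC B2) vB1 vB2; ring. Qed.

(** Only the X terms of dJ have a component along v, and they enter through the symmetric matrix f1
    + f2 G, which can be moved onto B to give J. This accounts for test vectors not orthogonal to
    v. *)
Lemma dot_v_dJ k X1 X2 :
  dot k B1 * dot v (dJ1 X1 X2) + dot k B2 * dot v (dJ2 X1 X2) =
  dot k curJ1 * dot v X1 + dot k curJ2 * dot v X2.
Proof.
rewrite (dotC v (dJ1 _ _)) (dotC v (dJ2 _ _)) (dotC k curJ1) (dotC k curJ2) !dot_combl.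
by rewrite (dotC B1 v) (dotC B2 v) vB1 vB2 (dotC X1 v) (dotC X2 v) (dotC B1 k) (dotC B2 k); ring.
Qed.

End SelfInteraction.

(* With [B = tcontract v (hodge T)], the self-duality condition reads
   [- E2 = J1], [E1 = J2] for [E = tcontract v T]; pairing with arbitrary test
   vectors [X1], [X2] moves the derivative of [J] onto them by the symmetry of the
   Hessian of [f]. *)
Lemma self_duality_variation v k (T1 T2 : tens) (f1 f2 f11 f12 f22 : R) :
  let B1 := tcontract v (hodge T1) in let B2 := tcontract v (hodge T2) in
  let z1' := 2^-1 * (dot B1 B1 + dot B2 B2) in
  let z2' := 4^-1 * (dot B1 B1 * dot B1 B1 + dot B1 B2 * dot B1 B2
    + (dot B1 B2 * dot B1 B2 + dot B2 B2 * dot B2 B2)) in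
  antisym T1 -> antisym T2 -> dot v v = -1 -> dot k v = 0 ->
  2 * f1 * f11 + 2 * f1 * f2 + 2 * z1' * (f11 * f2 + f1 * f12)
    + 4 * z1' * f2 ^+ 2 + 4 * (z1' ^+ 2 - z2') * f2 * f12 = 0 ->
  2 * f1 * f12 + 2 * z1' * (f12 * f2 + f1 * f22) - 2 * f2 ^+ 2
    + 4 * (z1' ^+ 2 - z2') * f2 * f22 = 0 ->
  f1 ^+ 2 + 2 * z1' * f1 * f2 + 2 * (z1' ^+ 2 - z2') * f2 ^+ 2 = 1 ->
  (forall m, - tcontract v T2 m = curJ1 B1 B2 f1 f2 m) ->
  (forall m, tcontract v T1 m = curJ2 B1 B2 f1 f2 m) ->
  (forall m, - tcontract k T2 m =
     dJ1 B1 B2 f1 f2 f11 f12 f22 (tcontract k (hodge T1)) (tcontract k (hodge T2)) m) /\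
  (forall m, tcontract k T1 m =
     dJ2 B1 B2 f1 f2 f11 f12 f22 (tcontract k (hodge T1)) (tcontract k (hodge T2)) m).
Proof.
move=> B1 B2 z1' z2' T1N T2N vv kv dQ1 dQ2 Q SD1 SD2.
have vB1 : dot v B1 = 0 by exact: dot_tcontract_self (hodge_antisym T1).
have vB2 : dot v B2 = 0 by exact: dot_tcontract_self (hodge_antisym T2).
pose D1 := tcontract k (hodge T1); pose D2 := tcontract k (hodge T2).
have E1 : tcontract v T1 =1 curJ2 B1 B2 f1 f2 by [].
have E2 : tcontract v T2 =1 (fun m => - curJ1 B1 B2 f1 f2 m) by move=> m; rewrite -SD1 opprK.
have main X1 X2 : dot (fun m => - tcontract k T2 m) X1 + dot (tcontract k T1) X2 =
    dot (dJ1 B1 B2 f1 f2 f11 f12 f22 D1 D2) X1 + dot (dJ2 B1 B2 f1 f2 f11 f12 f22 D1 D2) X2.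
  rewrite dJ_symmetric dotNl.
  rewrite (dot_tcontract k X1 T2N vv) (dot_tcontract k X2 T1N vv) -/B1 -/B2.
  set Y1 := dJ1 _ _ _ _ _ _ _ X1 X2; set Y2 := dJ2 _ _ _ _ _ _ _ X1 X2.
  rewrite (dotC Y1) (dotC Y2) /D1 /D2.
  rewrite (dot_tcontract_hodge k Y1 T1N vv) (dot_tcontract_hodge k Y2 T2N vv) kv -/B1 -/B2.
  have kE1 := eq_dot (frefl k) E1; have kE2 := eq_dot (frefl k) E2.
  rewrite (dotC k (fun m => - _)) dotNl (dotC _ k) in kE2.
  have V1 := eq_vol (frefl v) (frefl k) E1 (frefl Y1).
  have V2 := eq_vol (frefl v) (frefl k) E2 (frefl Y2); rewrite volN3 in V2.
  (* [V] cancels the volumes produced by the decompositions along v, and [W] the remaining terms in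
     v.X1 and v.X2. *)
  have V := vol_dJ v dQ1 dQ2 Q k X1 X2.
  have W := dot_v_dJ vB1 vB2 f1 f2 f11 f12 f22 k X1 X2.
  rewrite (volC v k B2 X1) -/Y1 -/Y2 in V; rewrite -/Y1 -/Y2 in W.
  rewrite (volC v k _ Y1) in V.
  rewrite kE1 kE2 V1 V2 !mul0r !subr0.
  by move: V W; move: (vol v k) (dot k) (dot v) => a b c; lra.
have dot0 (a : vect) : dot a (fun=> 0) = 0.
  by rewrite /dot big1// => m _; rewrite mulr0.
split; apply: vect4P => X.
  by have := main X (fun=> 0); rewrite !dot0 !addr0.
by have := main (fun=> 0) X; rewrite !dot0 !add0r.
Qed.

(* The divergence on the right-hand side is that of
   [K^m = 1/4 eps^(mnpq) (dA1_n T2_pq - dA2_n T1_pq) + eps^(mnpq) phi u_n Z1_p Z2_q],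
   where [Z = (H - J) / s], [u = s v], [dA1 = - phi Z2] and [dA2 = phi Z1]. *)
Lemma lagrangian_variation v k w (T1 T2 P1 P2 : tens) (s phi : R) (J1 J2 Z1 Z2 : vect)
    (dZ1 dZ2 : tens) :
  let E1 := tcontract v T1 in let E2 := tcontract v T2 in
  let B1 := tcontract v (hodge T1) in let B2 := tcontract v (hodge T2) in
  let D1 := fun m n => P1 m n - P1 n m in let D2 := fun m n => P2 m n - P2 n m in
  let dE1 := fun m => tcontract k T1 m + tcontract v D1 m in
  let dE2 := fun m => tcontract k T2 m + tcontract v D2 m in
  let dB1 := fun m => tcontract k (hodge T1) m + tcontract v (hodge D1) m in
  let dB2 := fun m => tcontract k (hodge T2) m + tcontract v (hodge D2) m in
  antisym T1 -> antisym T2 -> dot v v = -1 -> s != 0 ->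
  (forall m, k m = w m / s + v m * dot v w / s) ->
  dot v J1 = 0 -> dot v J2 = 0 -> vol v w J1 J2 = vol v w B1 B2 ->
  (forall m, Z1 m = (- E2 m - J1 m) / s) -> (forall m, Z2 m = (E1 m - J2 m) / s) ->
  (forall m n, P1 m n = - (dZ2 m n * phi + Z2 n * w m)) ->
  (forall m n, P2 m n = dZ1 m n * phi + Z1 n * w m) ->
  2^-1 * (- dot dE2 B1 - dot E2 dB1 + dot dE1 B2 + dot E1 dB2) - dot J1 dB1 - dot J2 dB2 =
  4^-1 * (\sum_(m < 4) \sum_(n < 4) \sum_(p < 4) \sum_(q < 4)
    levi_civita m n p q * (P1 m n * T2 p q - P2 m n * T1 p q))
  + \sum_(m < 4) \sum_(n < 4) \sum_(p < 4) \sum_(q < 4)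
    levi_civita m n p q * (s * v n * (w m * Z1 p * Z2 q + phi * (dZ1 m p * Z2 q + Z1 p * dZ2 m q))).
Proof.
move=> E1 E2 B1 B2 D1 D2 dE1 dE2 dB1 dB2 T1N T2N vv s0 kE vJ1 vJ2 volJ Z1E Z2E P1E P2E.
have dotDl a b c : dot (fun m => a m + b m) c = dot a c + dot b c.
  by rewrite /dot -big_split; apply: eq_bigr => m _; rewrite mulrDr mulrDl.
have D1N : antisym D1 by move=> m n; rewrite /D1 opprB.
have D2N : antisym D2 by move=> m n; rewrite /D2 opprB.
have vE1 : dot v E1 = 0 by exact: dot_tcontract_self T1N.
have vE2 : dot v E2 = 0 by exact: dot_tcontract_self T2N.
have vB1 : dot v B1 = 0 by exact: dot_tcontract_self (hodge_antisym T1).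
have vB2 : dot v B2 = 0 by exact: dot_tcontract_self (hodge_antisym T2).
have kv : dot k v = 0 by exact: dot_linear_rel vv kE.
have vkw b c : vol v k b c = vol v w b c / s by exact: vol_linear_rel.
(* Variation through v alone: k and all paired vectors are orthogonal to v, so only volumes survive,
   and there k may be replaced by w / s. *)
have K12 : dot (tcontract k T1) B2 = vol v w B1 B2 / s.
  by rewrite (dot_tcontract k B2 T1N vv) kv vB2 -/B1 vkw; ring.
have K21 : dot (tcontract k T2) B1 = - vol v w B1 B2 / s.
  by rewrite (dot_tcontract k B1 T2N vv) kv vB1 -/B2 vkw volC; ring.
have S12 : dot (tcontract k (hodge T1)) E2 = - vol v w E1 E2 / s.
  by rewrite (dot_tcontract_hodge k E2 T1N vv) kv vE2 -/E1 vkw; ring.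
have S21 : dot (tcontract k (hodge T2)) E1 = vol v w E1 E2 / s.
  by rewrite (dot_tcontract_hodge k E1 T2N vv) kv vE1 -/E2 vkw volC; ring.
have S1J : dot (tcontract k (hodge T1)) J1 = - vol v w E1 J1 / s.
  by rewrite (dot_tcontract_hodge k J1 T1N vv) kv vJ1 -/E1 vkw; ring.
have S2J : dot (tcontract k (hodge T2)) J2 = - vol v w E2 J2 / s.
  by rewrite (dot_tcontract_hodge k J2 T2N vv) kv vJ2 -/E2 vkw; ring.
have half (P T : tens) : antisym T ->
    \sum_(m < 4) \sum_(n < 4) \sum_(p < 4) \sum_(q < 4)
      levi_civita m n p q * ((P m n - P n m) * T p q) =
    2 * \sum_(m < 4) \sum_(n < 4) \sum_(p < 4) \sum_(q < 4)
      levi_civita m n p q * (P m n * T p q).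
  by move=> TN; rewrite !levi_sumE !(antisymE TN); ring.
(* Integration by parts in algebraic form: the electric variation due to D is traded for the
   magnetic one and the first sum of the claim. What is left is s Z paired with the magnetic
   variation. *)
have W12 := levi_wedge D1N T2N vv; rewrite (half _ _ T2N) -/E2 -/B2 in W12.
have W21 := levi_wedge D2N T1N vv; rewrite (half _ _ T1N) -/E1 -/B1 in W21.
have Z1c : (fun m => s * Z1 m) =1 comb (-1) (-1) 0 0 E2 J1 E2 J1.
  by move=> m; rewrite Z1E /comb; field.
have Z2c : (fun m => s * Z2 m) =1 comb 1 (-1) 0 0 E1 J2 E1 J2.
  by move=> m; rewrite Z2E /comb; field.
have C1 := tcontract_hodge_curl v P1 (fun m => s * Z1 m).
rewrite -/D1 (eq_dot (frefl _) Z1c) dotC dot_combl (dotC E2) (dotC J1) in C1.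
have C2 := tcontract_hodge_curl v P2 (fun m => s * Z2 m).
rewrite -/D2 (eq_dot (frefl _) Z2c) dotC dot_combl (dotC E1) (dotC J2) in C2.
have VZ : s ^+ 2 * vol v w Z1 Z2 =
    vol v w E1 E2 + vol v w E2 J2 + vol v w E1 J1 + vol v w J1 J2.
  transitivity (vol v w (fun m => s * Z1 m) (fun m => s * Z2 m)).
    by rewrite /vol !levi_sumE; ring.
  rewrite (eq_vol (frefl v) (frefl w) Z1c Z2c) vol_comb3 !vol_comb4.
  by rewrite (volC v w E1 E2) (volC v w E1 J1); ring.
(* Once J1, J2 are replaced by B1, B2, the right side is exactly the total variation through v. *)
have VZs : s * vol v w Z1 Z2 =
    (vol v w E1 E2 + vol v w E2 J2 + vol v w E1 J1 + vol v w B1 B2) / s.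
  by rewrite -volJ -VZ; field.
(* The two pairings together contain the w term twice, the second sum of the claim only once; the
   difference is the subtracted volume. *)
have I : - \sum_(m < 4) \sum_(n < 4) \sum_(p < 4) \sum_(q < 4)
        levi_civita m n p q * (v m * P1 n p * (s * Z1 q))
      - \sum_(m < 4) \sum_(n < 4) \sum_(p < 4) \sum_(q < 4)
        levi_civita m n p q * (v m * P2 n p * (s * Z2 q)) =
    \sum_(m < 4) \sum_(n < 4) \sum_(p < 4) \sum_(q < 4) levi_civita m n p q *
      (s * v n * (w m * Z1 p * Z2 q + phi * (dZ1 m p * Z2 q + Z1 p * dZ2 m q)))
    - s * vol v w Z1 Z2.
  by rewrite /vol !levi_sumE !P1E !P2E; ring.
have split12 : \sum_(m < 4) \sum_(n < 4) \sum_(p < 4) \sum_(q < 4)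
    levi_civita m n p q * (P1 m n * T2 p q - P2 m n * T1 p q) =
    \sum_(m < 4) \sum_(n < 4) \sum_(p < 4) \sum_(q < 4) levi_civita m n p q * (P1 m n * T2 p q)
    - \sum_(m < 4) \sum_(n < 4) \sum_(p < 4) \sum_(q < 4) levi_civita m n p q * (P2 m n * T1 p q).
  by rewrite !levi_sumE; ring.
rewrite split12 (dotC E2 dB1) (dotC E1 dB2) (dotC J1) (dotC J2) !dotDl.
rewrite K12 K21 S12 S21 S1J S2J.
rewrite -(subrK (s * vol v w Z1 Z2) (\sum_(m < 4) \sum_(n < 4) \sum_(p < 4) \sum_(q < 4) levi_civita m n p q * (s * v n * _))) -I VZs.
rewrite -[- \sum_(m < 4) _]C1 in I *.
rewrite mulrDl mulrDl mulrDl.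
lra.
Qed.

(** The terms in [du] vanish because u is a gradient, those in S, the second derivatives of the
    potentials, by the Bianchi identity. *)
Lemma divergence_closed (P1 P2 T1 T2 dZ1 dZ2 du : tens) (Z1 Z2 us w : vect) (phi : R)
    (S1 S2 : 'I_4 -> tens) :
  (forall m n, du m n = du n m) ->
  (forall m n p, S1 m n p = S1 n m p) -> (forall m n p, S2 m n p = S2 n m p) ->
  \sum_(m < 4) \sum_(n < 4) \sum_(p < 4) \sum_(q < 4) levi_civita m n p q *
    (4^-1 * (P1 m n * T2 p q - P2 m n * T1 p q)
     + us n * (w m * Z1 p * Z2 q + phi * (dZ1 m p * Z2 q + Z1 p * dZ2 m q))
     + du m n * (phi * (Z1 p * Z2 q))
     - 4^-1 * phi * (Z2 n * (S2 m p q - S2 m q p) + Z1 n * (S1 m p q - S1 m q p))) =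
  4^-1 * (\sum_(m < 4) \sum_(n < 4) \sum_(p < 4) \sum_(q < 4)
    levi_civita m n p q * (P1 m n * T2 p q - P2 m n * T1 p q))
  + \sum_(m < 4) \sum_(n < 4) \sum_(p < 4) \sum_(q < 4) levi_civita m n p q *
    (us n * (w m * Z1 p * Z2 q + phi * (dZ1 m p * Z2 q + Z1 p * dZ2 m q))).
Proof.
move=> dus S1s S2s.
have sym : \sum_(m < 4) \sum_(n < 4) \sum_(p < 4) \sum_(q < 4) levi_civita m n p q *
    (du m n * (phi * (Z1 p * Z2 q))) = 0.
  rewrite levi_sumE (dus o1 o0) (dus o2 o0) (dus o3 o0) (dus o2 o1) (dus o3 o1) (dus o3 o2); ring.
have bianchi (S : 'I_4 -> tens) (a : vect) : (forall m n p, S m n p = S n m p) ->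
    \sum_(m < 4) \sum_(n < 4) \sum_(p < 4) \sum_(q < 4) levi_civita m n p q *
      (4^-1 * phi * (a n * (S m p q - S m q p))) = 0.
  move=> Ss; rewrite levi_sumE !(Ss o1 o0) !(Ss o2 o0) !(Ss o3 o0) !(Ss o2 o1) !(Ss o3 o1) !(Ss o3 o2); ring.
have b1 := bianchi _ Z1 S1s; have b2 := bianchi _ Z2 S2s.
have lin (A B C D E : 'I_4 -> 'I_4 -> 'I_4 -> 'I_4 -> R) :
    \sum_(m < 4) \sum_(n < 4) \sum_(p < 4) \sum_(q < 4) levi_civita m n p q *
      (4^-1 * A m n p q + B m n p q + C m n p q - (D m n p q + E m n p q)) =
    4^-1 * (\sum_(m < 4) \sum_(n < 4) \sum_(p < 4) \sum_(q < 4) levi_civita m n p q * A m n p q)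
    + \sum_(m < 4) \sum_(n < 4) \sum_(p < 4) \sum_(q < 4) levi_civita m n p q * B m n p q
    + \sum_(m < 4) \sum_(n < 4) \sum_(p < 4) \sum_(q < 4) levi_civita m n p q * C m n p q
    - (\sum_(m < 4) \sum_(n < 4) \sum_(p < 4) \sum_(q < 4) levi_civita m n p q * D m n p q
      + \sum_(m < 4) \sum_(n < 4) \sum_(p < 4) \sum_(q < 4) levi_civita m n p q * E m n p q).
  by rewrite !levi_sumE; ring.
have := lin (fun m n p q => P1 m n * T2 p q - P2 m n * T1 p q)
  (fun m n p q => us n * (w m * Z1 p * Z2 q + phi * (dZ1 m p * Z2 q + Z1 p * dZ2 m q)))
  (fun m n p q => du m n * (phi * (Z1 p * Z2 q)))
  (fun m n p q => 4^-1 * phi * (Z2 n * (S2 m p q - S2 m q p)))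
  (fun m n p q => 4^-1 * phi * (Z1 n * (S1 m p q - S1 m q p))).
rewrite /= sym b1 b2 !addr0 subr0 => <-.
by do 4!(apply: eq_bigr => ? _); rewrite -mulrDr.
Qed.

End Algebra.

(** * Variation along a line *)

Local Notation a0 := (@Ordinal 2 0 isT).
Local Notation a1 := (@Ordinal 2 1 isT).

Section Variations.
Variable R : realType.
Local Notation vect := ('I_4 -> R).
Local Notation tens := ('I_4 -> 'I_4 -> R).
Implicit Types (g h : R -> R) (t : R).

Lemma sum2E (V : nmodType) (k : 'I_2 -> V) : \sum_(i < 2) k i = k a0 + k a1.
Proof. by rewrite !big_ord_recl big_ord0 addr0; congr (k _ + k _); apply: val_inj. Qed.

Lemma ord2P (al : 'I_2) : al = a0 \/ al = a1.
Proof. by case: al => [[|[|m]] Hm]//; [left|right]; apply: val_inj. Qed.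

Lemma is_deriveD_fun t g h dg dh : is_derive t 1 g dg -> is_derive t 1 h dh ->
  is_derive t 1 (fun e => g e + h e) (dg + dh).
Proof. by move=> gd hd; exact: is_deriveD. Qed.

Lemma is_deriveN_fun t g dg : is_derive t 1 g dg -> is_derive t 1 (fun e => - g e) (- dg).
Proof. by move=> gd; exact: is_deriveN. Qed.

Lemma is_deriveM_fun t g h dg dh : is_derive t 1 g dg -> is_derive t 1 h dh ->
  is_derive t 1 (fun e => g e * h e) (dg * h t + g t * dh).
Proof.
move=> gd hd; apply: is_derive_eq (is_deriveM gd hd) _.
by rewrite addrC /GRing.scale/= [h t * dg]mulrC.
Qed.

Lemma is_deriveZ_fun t (b : R) g dg : is_derive t 1 g dg -> is_derive t 1 (fun e => b * g e) (b * dg).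
Proof. by move=> gd; exact: is_deriveZ. Qed.

Lemma is_derive_sum_fun n t (g : 'I_n -> R -> R) dg : (forall i, is_derive t 1 (g i) (dg i)) ->
  is_derive t 1 (fun e => \sum_(i < n) g i e) (\sum_(i < n) dg i).
Proof.
move=> gd; have := is_derive_sum gd; congr (is_derive _ _ _ _).
by apply/funext => e; rewrite fct_sumE.
Qed.

Lemma is_derive_affine t (b d : R) : is_derive t 1 (fun e => b + e * d) d.
Proof.
apply: is_derive_eq (is_deriveD_fun (is_derive_cst b t 1) (is_deriveM_fun (is_derive_id t 1) (is_derive_cst d t 1))) _.
by rewrite add0r mul1r mulr0 addr0.
Qed.

Lemma is_derive_is_diff t g dg : is_derive t 1 g dg -> is_diff t g ( *:%R^~ dg).
Proof.
move=> gd; have gD : derivable g t 1 by [].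
split; first exact/derivable1_diffP.
by rewrite deriv1E// derive1E derive_val.
Qed.

Lemma is_derive_comp2 t (f : R -> R -> R) g h (dg dh : R) : analytic_at f (g t, h t) ->
  is_derive t 1 g dg -> is_derive t 1 h dh ->
  is_derive t 1 (fun e => f (g e) (h e))
    (partial1 f (g t) (h t) * dg + partial2 f (g t) (h t) * dh).
Proof.
move=> fa /is_derive_is_diff gd /is_derive_is_diff hd.
have D := @is_diff_is_derive R R^o _ _ t 1 (@is_diff_comp2 R R^o f g _ h _ t fa gd hd).
by apply: is_derive_eq D _; rewrite /= !scale1r mulrC [dh * _]mulrC.
Qed.

Lemma is_derive_partial1 (f : R -> R -> R) s1 s2 : analytic_at f (s1, s2) ->
  is_derive s1 1 (fun t => f t s2) (partial1 f s1 s2).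
Proof.
move=> fa; apply: is_derive_eq (is_derive_comp2 (g := id) (h := fun=> s2) fa (is_derive_id s1 1) (is_derive_cst s2 s1 1)) _.
by rewrite mulr1 mulr0 addr0.
Qed.

Lemma is_derive_partial2 (f : R -> R -> R) s1 s2 : analytic_at f (s1, s2) ->
  is_derive s2 1 (fun t => f s1 t) (partial2 f s1 s2).
Proof.
move=> fa; apply: is_derive_eq (is_derive_comp2 (g := fun=> s1) (h := id) fa (is_derive_cst s1 s2 1) (is_derive_id s2 1)) _.
by rewrite mulr1 mulr0 add0r.
Qed.

Lemma is_derive_dot t (a b : R -> vect) da db :
  (forall m, is_derive t 1 (fun e => a e m) (da m)) ->
  (forall m, is_derive t 1 (fun e => b e m) (db m)) ->
  is_derive t 1 (fun e => dot (a e) (b e)) (dot da (b t) + dot (a t) db).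
Proof.
move=> ad bd; rewrite /dot -big_split/=; apply: is_derive_sum_fun => m.
apply: is_derive_eq (is_deriveM_fun (is_deriveZ_fun (metric m) (ad m)) (bd m)) _.
by [].
Qed.

Lemma is_derive_tcontract t (w : R -> vect) (T : R -> tens) dw dT m :
  (forall m, is_derive t 1 (fun e => w e m) (dw m)) ->
  (forall m n, is_derive t 1 (fun e => T e m n) (dT m n)) ->
  is_derive t 1 (fun e => tcontract (w e) (T e) m)
    (tcontract dw (T t) m + tcontract (w t) dT m).
Proof.
move=> wd Td; rewrite /tcontract -big_split/=; apply: is_derive_sum_fun => n.
exact: is_deriveM_fun (is_deriveZ_fun (metric n) (wd n)) (Td n m).
Qed.

Lemma is_derive_hodge t (T : R -> tens) dT m n :
  (forall m n, is_derive t 1 (fun e => T e m n) (dT m n)) ->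
  is_derive t 1 (fun e => hodge (T e) m n) (hodge dT m n).
Proof.
move=> Td; apply: is_deriveZ_fun; apply: is_derive_sum_fun => p; apply: is_derive_sum_fun => q.
Qed.

Definition unit_covector (us : vect) : vect := fun m => us m / Num.sqrt (- dot us us).

Lemma dot_unit_covector us : dot us us < 0 -> dot (unit_covector us) (unit_covector us) = -1.
Proof.
move=> u0; have s0 : 0 < Num.sqrt (- dot us us) by rewrite sqrtr_gt0 oppr_gt0.
have E : dot (unit_covector us) (unit_covector us) = dot us us / Num.sqrt (- dot us us) ^+ 2.
  rewrite {1}/dot mulr_suml; apply: eq_bigr => m _; rewrite /unit_covector; field.
  by rewrite gt_eqF.
by rewrite E sqr_sqrtr ?oppr_ge0 ?(ltW u0)// invrN mulrN mulfV// lt_eqF.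
Qed.

(** The factor 1 / s varies by (us.w) / s^3; the resulting second term projects w / s orthogonally
    to the unit covector. *)
Lemma is_derive_unit_covector (us w : vect) m : dot us us < 0 ->
  let s := Num.sqrt (- dot us us) in
  is_derive (0 : R) 1 (fun e => unit_covector (fun n => us n + e * w n) m)
    (w m / s + unit_covector us m * dot (unit_covector us) w / s).
Proof.
move=> u0 s; have s0 : 0 < s by rewrite sqrtr_gt0 oppr_gt0.
have ud n : is_derive (0 : R) 1 (fun e => us n + e * w n) (w n) by exact: is_derive_affine.
have us0 : (fun n => us n + 0 * w n) = us by apply/funext => n; rewrite mul0r addr0.
have dd := is_deriveN_fun (is_derive_dot ud ud); rewrite /= us0 in dd.
have sd : is_derive (- dot (fun n => us n + 0 * w n) (fun n => us n + 0 * w n)) 1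
   (fun r => (Num.sqrt r)^-1) (- 2^-1 * s^-1 ^+ 3).
  by rewrite us0; apply: is_derive_invsqrt; rewrite oppr_gt0.
have cd := @is_derive1_comp R _ (fun e => - dot (fun n => us n + e * w n) (fun n => us n + e * w n)) 0 _ _ sd dd.
apply: is_derive_eq (is_deriveM_fun (ud m) cd) _.
have -> : dot (unit_covector us) w = dot us w / s.
  rewrite /dot mulr_suml; apply: eq_bigr => n _; rewrite /unit_covector -/s; field.
  by rewrite gt_eqF.
rewrite /= mul0r addr0 us0 -/s (dotC w us) /unit_covector -/s; field.
by rewrite gt_eqF.
Qed.

Definition gram1 (b1 b2 : vect) : R := 2^-1 * (dot b1 b1 + dot b2 b2).
Definition gram2 (b1 b2 : vect) : R :=
  4^-1 * (dot b1 b1 * dot b1 b1 + dot b1 b2 * dot b1 b2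
    + (dot b1 b2 * dot b1 b2 + dot b2 b2 * dot b2 b2)).

Lemma z1E (h : 'M[R]_(2, 4)) : z1 h = gram1 (h a0) (h a1).
Proof. by rewrite /z1 sum2E. Qed.

Lemma z2E (h : 'M[R]_(2, 4)) : z2 h = gram2 (h a0) (h a1).
Proof.
have E i j : inner h i j = dot (h i) (h j) by [].
by rewrite /z2 !sum2E !E (dotC (h a1) (h a0)).
Qed.

Lemma J0E f (h : 'M[R]_(2, 4)) p :
  J f h a0 p = curJ1 (h a0) (h a1) (partial1 f (z1 h) (z2 h)) (partial2 f (z1 h) (z2 h)) p.
Proof.
rewrite mxE sum2E -/(dot (h a0) (h a0)) -/(dot (h a1) (h a0)) (dotC (h a1) (h a0)).
by rewrite /curJ1 /comb; ring.
Qed.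

Lemma J1E f (h : 'M[R]_(2, 4)) p :
  J f h a1 p = curJ2 (h a0) (h a1) (partial1 f (z1 h) (z2 h)) (partial2 f (z1 h) (z2 h)) p.
Proof.
by rewrite mxE sum2E -/(dot (h a0) (h a1)) -/(dot (h a1) (h a1)) /curJ2 /comb; ring.
Qed.

(** * Derivatives of f and J along a curve of magnetic parts *)

Section AlongCurve.
Variables (t : R) (b1 b2 : R -> vect) (db1 db2 : vect).
Hypothesis bd1 : forall m, is_derive t 1 (fun e => b1 e m) (db1 m).
Hypothesis bd2 : forall m, is_derive t 1 (fun e => b2 e m) (db2 m).
Let B1 := b1 t.
Let B2 := b2 t.

Lemma is_derive_gram1 : is_derive t 1 (fun e => gram1 (b1 e) (b2 e)) (dot B1 db1 + dot B2 db2).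
Proof.
apply: is_derive_eq (is_deriveZ_fun _ (is_deriveD_fun (is_derive_dot bd1 bd1) (is_derive_dot bd2 bd2))) _.
by rewrite (dotC db1) (dotC db2) -/B1 -/B2; field.
Qed.

Lemma is_derive_gram2 : is_derive t 1 (fun e => gram2 (b1 e) (b2 e))
  (dot B1 B1 * dot B1 db1 + dot B1 B2 * (dot B2 db1 + dot B1 db2) + dot B2 B2 * dot B2 db2).
Proof.
have D11 := is_derive_dot bd1 bd1; have D12 := is_derive_dot bd1 bd2; have D22 := is_derive_dot bd2 bd2.
apply: is_derive_eq (is_deriveZ_fun _ (is_deriveD_fun
  (is_deriveD_fun (is_deriveM_fun D11 D11) (is_deriveM_fun D12 D12))
  (is_deriveD_fun (is_deriveM_fun D12 D12) (is_deriveM_fun D22 D22)))) _.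
by rewrite !(dotC db1) !(dotC db2) -/B1 -/B2; field.
Qed.

Variable f : R -> R -> R.
Hypothesis fa : analytic_at f (gram1 B1 B2, gram2 B1 B2).
Let g1 e := gram1 (b1 e) (b2 e).
Let g2 e := gram2 (b1 e) (b2 e).
Let f1 := partial1 f (gram1 B1 B2) (gram2 B1 B2).
Let f2 := partial2 f (gram1 B1 B2) (gram2 B1 B2).
Let f11 := partial1 (partial1 f) (gram1 B1 B2) (gram2 B1 B2).
Let f12 := partial2 (partial1 f) (gram1 B1 B2) (gram2 B1 B2).
Let f22 := partial2 (partial2 f) (gram1 B1 B2) (gram2 B1 B2).

Lemma is_derive_f_gram : is_derive t 1 (fun e => f (gram1 (b1 e) (b2 e)) (gram2 (b1 e) (b2 e)))
  (dot (curJ1 B1 B2 f1 f2) db1 + dot (curJ2 B1 B2 f1 f2) db2).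
Proof.
apply: is_derive_eq (@is_derive_comp2 t f g1 g2 _ _ fa is_derive_gram1 is_derive_gram2) _.
by rewrite !dot_combl -/f1 -/f2; ring.
Qed.

Let d1 := @is_derive_comp2 t (partial1 f) g1 g2 _ _ (analytic_at_partial1 fa) is_derive_gram1 is_derive_gram2.
Let d2 := @is_derive_comp2 t (partial2 f) g1 g2 _ _ (analytic_at_partial2 fa) is_derive_gram1 is_derive_gram2.
Let f21E : partial1 (partial2 f) (gram1 B1 B2) (gram2 B1 B2) = f12 := esym (partial12 fa).

Lemma is_derive_curJ1 p : is_derive t 1
  (fun e => curJ1 (b1 e) (b2 e) (partial1 f (gram1 (b1 e) (b2 e)) (gram2 (b1 e) (b2 e)))
    (partial2 f (gram1 (b1 e) (b2 e)) (gram2 (b1 e) (b2 e))) p)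
  (dJ1 B1 B2 f1 f2 f11 f12 f22 db1 db2 p).
Proof.
have E : (fun e => curJ1 (b1 e) (b2 e) (partial1 f (gram1 (b1 e) (b2 e)) (gram2 (b1 e) (b2 e)))
    (partial2 f (gram1 (b1 e) (b2 e)) (gram2 (b1 e) (b2 e))) p) =
  (fun e => (partial1 f (gram1 (b1 e) (b2 e)) (gram2 (b1 e) (b2 e)) +
     partial2 f (gram1 (b1 e) (b2 e)) (gram2 (b1 e) (b2 e)) * dot (b1 e) (b1 e)) * b1 e p +
     partial2 f (gram1 (b1 e) (b2 e)) (gram2 (b1 e) (b2 e)) * dot (b1 e) (b2 e) * b2 e p).
  by apply/funext => e; rewrite /curJ1 /comb; ring.
rewrite E; apply: is_derive_eq (is_deriveD_fun
  (is_deriveM_fun (is_deriveD_fun d1 (is_deriveM_fun d2 (is_derive_dot bd1 bd1))) (bd1 p))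
  (is_deriveM_fun (is_deriveM_fun d2 (is_derive_dot bd1 bd2)) (bd2 p))) _.
rewrite -/B1 -/B2 f21E -/f1 -/f2 -/f11 -/f12 -/f22 (dotC db1 B1) (dotC db1 B2) /dJ1 /comb; ring.
Qed.

Lemma is_derive_curJ2 p : is_derive t 1
  (fun e => curJ2 (b1 e) (b2 e) (partial1 f (gram1 (b1 e) (b2 e)) (gram2 (b1 e) (b2 e)))
    (partial2 f (gram1 (b1 e) (b2 e)) (gram2 (b1 e) (b2 e))) p)
  (dJ2 B1 B2 f1 f2 f11 f12 f22 db1 db2 p).
Proof.
have E : (fun e => curJ2 (b1 e) (b2 e) (partial1 f (gram1 (b1 e) (b2 e)) (gram2 (b1 e) (b2 e)))
    (partial2 f (gram1 (b1 e) (b2 e)) (gram2 (b1 e) (b2 e))) p) =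
  (fun e => partial2 f (gram1 (b1 e) (b2 e)) (gram2 (b1 e) (b2 e)) * dot (b1 e) (b2 e) * b1 e p +
    (partial1 f (gram1 (b1 e) (b2 e)) (gram2 (b1 e) (b2 e)) +
     partial2 f (gram1 (b1 e) (b2 e)) (gram2 (b1 e) (b2 e)) * dot (b2 e) (b2 e)) * b2 e p).
  by apply/funext => e; rewrite /curJ2 /comb; ring.
rewrite E; apply: is_derive_eq (is_deriveD_fun
  (is_deriveM_fun (is_deriveM_fun d2 (is_derive_dot bd1 bd2)) (bd1 p))
  (is_deriveM_fun (is_deriveD_fun d1 (is_deriveM_fun d2 (is_derive_dot bd2 bd2))) (bd2 p))) _.
rewrite -/B1 -/B2 f21E -/f1 -/f2 -/f11 -/f12 -/f22 (dotC db2 B2) (dotC db1 B2) /dJ2 /comb; ring.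
Qed.

End AlongCurve.

(** * Consequences of the equation and of analyticity on U *)

Section Equation.
Variables (f : R -> R -> R) (U : set (R * R)).
Hypothesis U_open : open U.
Hypothesis f_analytic : forall z, U z -> analytic_at f z.
Hypothesis f_equation : forall s1 s2 : R, U (s1, s2) ->
  partial1 f s1 s2 ^+ 2 + 2 * s1 * partial1 f s1 s2 * partial2 f s1 s2
    + 2 * (s1 ^+ 2 - s2) * partial2 f s1 s2 ^+ 2 = 1.

Lemma derive_near_cst (g : R -> R) (x d : R) : is_derive x 1 g d ->
  (\forall y \near x, g y = 1) -> d = 0.
Proof.
move=> gd g1; have <- := @derive_val _ _ _ _ _ _ _ gd.
have -> : 'D_1 g x = 'D_1 (fun=> 1 : R) x.
  apply: near_eq_derive.
  by apply: filterS g1 => y ->.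
exact: derive_cst.
Qed.

Lemma open_slice1 s1 s2 : U (s1, s2) -> \forall t \near s1, U (t, s2).
Proof.
move=> Us; have [[A B] [/= nA nB] AB] : nbhs (s1, s2) U by apply: open_nbhs_nbhs; split.
by apply: filterS nA => t At; apply: AB; split => //=; exact: nbhs_singleton.
Qed.

Lemma open_slice2 s1 s2 : U (s1, s2) -> \forall t \near s2, U (s1, t).
Proof.
move=> Us; have [[A B] [/= nA nB] AB] : nbhs (s1, s2) U by apply: open_nbhs_nbhs; split.
by apply: filterS nB => t At; apply: AB; split => //=; exact: nbhs_singleton.
Qed.

(** As [U] is open, the equation holds along a whole slice through the point and may be
    differentiated there. *)
Lemma f_equation_derive1 s1 s2 : U (s1, s2) ->
  let f1 := partial1 f s1 s2 in let f2 := partial2 f s1 s2 in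
  let f11 := partial1 (partial1 f) s1 s2 in let f12 := partial2 (partial1 f) s1 s2 in
  2 * f1 * f11 + 2 * f1 * f2 + 2 * s1 * (f11 * f2 + f1 * f12)
  + 4 * s1 * f2 ^+ 2 + 4 * (s1 ^+ 2 - s2) * f2 * f12 = 0.
Proof.
move=> Us f1 f2 f11 f12; have fa := f_analytic Us.
have f21 : partial1 (partial2 f) s1 s2 = f12 by exact: esym (partial12 fa).
have d1 := is_derive_partial1 (analytic_at_partial1 fa).
have d2 := is_derive_partial1 (analytic_at_partial2 fa).
have ds := is_derive_id s1 (1 : R).
(* Squares and the difference are spelled out as products and a sum, matching the derivative rules
   literally. *)
have near1 : \forall t \near s1, partial1 f t s2 * partial1 f t s2
    + 2 * t * partial1 f t s2 * partial2 f t s2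
    + 2 * (t * t + - s2) * (partial2 f t s2 * partial2 f t s2) = 1.
  apply: filterS (open_slice1 Us) => t Ut.
  rewrite -[RHS](f_equation Ut); by ring.
have D : is_derive s1 1 (fun t => partial1 f t s2 * partial1 f t s2
    + 2 * t * partial1 f t s2 * partial2 f t s2
    + 2 * (t * t + - s2) * (partial2 f t s2 * partial2 f t s2)) _ :=
  is_deriveD_fun (is_deriveD_fun (is_deriveM_fun d1 d1)
    (is_deriveM_fun (is_deriveM_fun (is_deriveZ_fun 2 ds) d1) d2))
    (is_deriveM_fun (is_deriveZ_fun 2 (is_deriveD_fun (is_deriveM_fun ds ds) (is_derive_cst (- s2) s1 1)))
      (is_deriveM_fun d2 d2)).
have D0 := derive_near_cst D near1.
move: D0; rewrite f21 /f1 /f2 /f11 /f12 /cst/=.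
move: (partial1 f s1 s2) (partial2 f s1 s2) (partial1 (partial1 f) s1 s2) (partial2 (partial1 f) s1 s2) => b1 b2 b11 b12 D0.
by rewrite -[RHS]D0; ring.
Qed.

Lemma f_equation_derive2 s1 s2 : U (s1, s2) ->
  let f1 := partial1 f s1 s2 in let f2 := partial2 f s1 s2 in
  let f12 := partial2 (partial1 f) s1 s2 in let f22 := partial2 (partial2 f) s1 s2 in
  2 * f1 * f12 + 2 * s1 * (f12 * f2 + f1 * f22) - 2 * f2 ^+ 2
  + 4 * (s1 ^+ 2 - s2) * f2 * f22 = 0.
Proof.
move=> Us f1 f2 f12 f22; have fa := f_analytic Us.
have d1 := is_derive_partial2 (analytic_at_partial1 fa).
have d2 := is_derive_partial2 (analytic_at_partial2 fa).
have ds := is_derive_id s2 (1 : R).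
have near1 : \forall t \near s2, partial1 f s1 t * partial1 f s1 t
    + 2 * s1 * (partial1 f s1 t * partial2 f s1 t)
    + 2 * (s1 ^+ 2 + - t) * (partial2 f s1 t * partial2 f s1 t) = 1.
  apply: filterS (open_slice2 Us) => t Ut.
  rewrite -[RHS](f_equation Ut); by ring.
have D : is_derive s2 1 (fun t => partial1 f s1 t * partial1 f s1 t
    + 2 * s1 * (partial1 f s1 t * partial2 f s1 t)
    + 2 * (s1 ^+ 2 + - t) * (partial2 f s1 t * partial2 f s1 t)) _ :=
  is_deriveD_fun (is_deriveD_fun (is_deriveM_fun d1 d1)
    (is_deriveZ_fun (2 * s1) (is_deriveM_fun d1 d2)))
    (is_deriveM_fun (is_deriveZ_fun 2 (is_deriveD_fun (is_derive_cst (s1 ^+ 2) s2 1) (is_deriveN_fun ds)))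
      (is_deriveM_fun d2 d2)).
have D0 := derive_near_cst D near1.
move: D0; rewrite /f1 /f2 /f12 /f22 /cst/=.
move: (partial1 f s1 s2) (partial2 f s1 s2) (partial2 (partial1 f) s1 s2) (partial2 (partial2 f) s1 s2) => b1 b2 b12 b22 D0.
by rewrite -[RHS]D0; ring.
Qed.

Lemma J_is_derive (h : 'M[R]_(2, 4)) : U (z1 h, z2 h) -> forall (al : 'I_2) (p : 'I_4),
  is_derive h (metric p *: delta_mx al p) (fun h' : 'M[R]_(2, 4) => f (z1 h') (z2 h')) (J f h al p).
Proof.
move=> Uh al p; apply/is_deriveP_line.
pose X (i : 'I_2) (q : 'I_4) : R := metric p * ((i == al) && (q == p))%:R.
have -> : (fun t : R => f (z1 (t *: (metric p *: delta_mx al p) + h))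
      (z2 (t *: (metric p *: delta_mx al p) + h))) =
   (fun t => f (gram1 (fun q => h a0 q + t * X a0 q) (fun q => h a1 q + t * X a1 q))
     (gram2 (fun q => h a0 q + t * X a0 q) (fun q => h a1 q + t * X a1 q))).
  apply/funext => t; rewrite z1E z2E.
  have E i : (t *: (metric p *: delta_mx al p) + h) i = (fun q => h i q + t * X i q).
    by apply/funext => q; rewrite !mxE addrC.
  by rewrite !E.
have hX i : (fun q => h i q + 0 * X i q) = h i by apply/funext => q; rewrite mul0r addr0.
have bd i m : is_derive (0 : R) 1 (fun e => h i m + e * X i m) (X i m) by exact: is_derive_affine.
have fa : analytic_at f (gram1 (fun q => h a0 q + 0 * X a0 q) (fun q => h a1 q + 0 * X a1 q),
    gram2 (fun q => h a0 q + 0 * X a0 q) (fun q => h a1 q + 0 * X a1 q)).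
  by rewrite !hX -z1E -z2E; exact: f_analytic.
apply: is_derive_eq (is_derive_f_gram (bd a0) (bd a1) fa) _.
rewrite /= !hX -z1E -z2E.
(* The metric factor in the direction meets the one in [dot], and the square of either is 1. *)
have dotX (j : vect) i : dot j (X i) = if i == al then j p else 0.
  rewrite /dot (bigD1 p)//= big1 ?addr0.
    rewrite /X eqxx andbT; case: eqP => _; last by rewrite !mulr0.
    by rewrite mulr1 mulrAC -[RHS]mul1r; congr (_ * _); rewrite /metric; case: ifP => _; ring.
  by move=> q /negbTE qp; rewrite /X qp andbF !mulr0.
rewrite !dotX; case: (ord2P al) => ->; rewrite ?J0E ?J1E/=; by rewrite ?addr0 ?add0r.
Qed.

End Equation.
End Variations.

(** * Variation of the fields *)

Section Fields.
Variable R : realType.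
Local Notation vect := ('I_4 -> R).
Local Notation tens := ('I_4 -> 'I_4 -> R).
Implicit Types (c : config R) (x : 'rV[R]_4) (us w : vect) (T : 'I_2 -> tens).

(** The fields at x depend only on the values of u and F there, so a variation reduces to a curve in
    finite-dimensional data. *)
Definition pt_H us T : 'M[R]_(2, 4) :=
  \matrix_(al < 2, m < 4) \sum_(be < 2) Leps be al * tcontract (unit_covector us) (T be) m.

Definition pt_Htilde us T : 'M[R]_(2, 4) :=
  \matrix_(al < 2, m < 4) tcontract (unit_covector us) (hodge (T al)) m.

Lemma HE c x : H c x = pt_H (u c ^~ x) (fun al m n => F c al m n x).
Proof. by []. Qed.

Lemma HtildeE c x : Htilde c x = pt_Htilde (u c ^~ x) (fun al m n => F c al m n x).
Proof. by []. Qed.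

Lemma pt_H0 us T : pt_H us T a0 = (fun m => - tcontract (unit_covector us) (T a1) m).
Proof. by apply/funext => m; rewrite mxE sum2E /Leps/=; ring. Qed.

Lemma pt_H1 us T : pt_H us T a1 = tcontract (unit_covector us) (T a0).
Proof. by apply/funext => m; rewrite mxE sum2E /Leps/=; ring. Qed.

Lemma pt_HtildeE us T al : pt_Htilde us T al = tcontract (unit_covector us) (hodge (T al)).
Proof. by apply/funext => m; rewrite mxE. Qed.

Definition pt_Z (f : R -> R -> R) us T (al : 'I_2) : vect := fun m =>
  (pt_H us T al m - J f (pt_Htilde us T) al m) / Num.sqrt (- dot us us).

(** The current of [lagrangian_variation] after inserting the gauge variations - phi Z2 and phi
    Z1. *)
Definition pt_current (f : R -> R -> R) us T (phi : R) (m : 'I_4) : R :=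
  \sum_(n < 4) \sum_(p < 4) \sum_(q < 4) levi_civita m n p q *
    (phi * (us n * (pt_Z f us T a0 p * pt_Z f us T a1 q)
            - 4^-1 * (pt_Z f us T a1 n * T a1 p q + pt_Z f us T a0 n * T a0 p q))).

(** The current needs only first derivatives of the potentials and of a, and the value of phi, all
    of which a 1-jet retains. *)
Definition kappa (f : R -> R -> R) (jA : 'I_2 -> 'I_4 -> seq 'I_4 -> R)
    (ja jphi : seq 'I_4 -> R) : 'I_4 -> R :=
  pt_current f (fun m => ja [:: m]) (fun al m n => jA al n [:: m] - jA al m [:: n]) (jphi [::]).

Definition current (f : R -> R -> R) c (phi : 'rV[R]_4 -> R) (m : 'I_4) x : R :=
  pt_current f (u c ^~ x) (fun al m n => F c al m n x) (phi x) m.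

Lemma local_currentE f c phi m : local_current 1 (kappa f) c phi m = current f c phi m.
Proof. by []. Qed.

Definition Zfield (f : R -> R -> R) c (al : 'I_2) (m : 'I_4) x : R :=
  pt_Z f (u c ^~ x) (fun al m n => F c al m n x) al m.

Lemma delta_gauge0 f c phi m x : delta_gauge f c phi a0 m x = - (Zfield f c a1 m x * phi x).
Proof. by rewrite /delta_gauge sum2E /Leps/= /Zfield /pt_Z -HE -HtildeE /usq -/(dot _ _); ring. Qed.

Lemma delta_gauge1 f c phi m x : delta_gauge f c phi a1 m x = Zfield f c a0 m x * phi x.
Proof. by rewrite /delta_gauge sum2E /Leps/= /Zfield /pt_Z -HE -HtildeE /usq -/(dot _ _); ring. Qed.

(** * Smoothness of the fields, the gauge variation and the current *)

Section Smoothness.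
Variables (f : R -> R -> R) (U : set (R * R)) (c : config R).
Hypothesis f_analytic : forall z, U z -> analytic_at f z.
Hypothesis c_adm : admissible U c.

Lemma smooth_u m : smooth (u c m).
Proof. by case: c_adm => _ cs _ _; exact: smooth_pd. Qed.

Lemma smooth_F al m n : smooth (F c al m n).
Proof. by case: c_adm => cg _ _ _; apply: smoothB; exact: smooth_pd. Qed.

Lemma smooth_usq : smooth (usq c).
Proof.
apply: smooth_sum => m; apply: smoothM; last exact: smooth_u.
by apply: smoothM; [exact: smooth_cst|exact: smooth_u].
Qed.

Lemma smooth_inv_norm : smooth (fun x => (Num.sqrt (- usq c x))^-1).
Proof.
apply: smooth_invsqrt => [x|]; last exact: (smoothN smooth_usq).
by rewrite oppr_gt0; case: c_adm.
Qed.

Lemma smooth_v m : smooth (v c m).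
Proof. by apply: smoothM smooth_inv_norm; exact: smooth_u. Qed.

Lemma smooth_Fdual al m n : smooth (Fdual c al m n).
Proof.
apply: smoothM; first exact: smooth_cst.
apply: smooth_sum => p; apply: smooth_sum => q.
by do 2![apply: smoothM; first exact: smooth_cst]; exact: smooth_F.
Qed.

Lemma smooth_H al m : smooth (fun x => H c x al m).
Proof.
have -> : (fun x => H c x al m) =
    (fun x => \sum_(be < 2) Leps be al * \sum_(n < 4) metric n * v c n x * F c be n m x).
  by apply/funext => x; rewrite mxE.
apply: smooth_sum => be; apply: smoothM; first exact: smooth_cst.
apply: smooth_sum => n; apply: smoothM; last exact: smooth_F.
by apply: smoothM; [exact: smooth_cst|exact: smooth_v].
Qed.

Lemma smooth_Htilde al m : smooth (fun x => Htilde c x al m).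
Proof.
have -> : (fun x => Htilde c x al m) =
    (fun x => \sum_(n < 4) metric n * v c n x * Fdual c al n m x).
  by apply/funext => x; rewrite mxE.
apply: smooth_sum => n; apply: smoothM; last exact: smooth_Fdual.
by apply: smoothM; [exact: smooth_cst|exact: smooth_v].
Qed.

Lemma smooth_inner al be : smooth (fun x => inner (Htilde c x) al be).
Proof.
apply: smooth_sum => m; apply: smoothM; last exact: smooth_Htilde.
by apply: smoothM; [exact: smooth_cst|exact: smooth_Htilde].
Qed.

Lemma smooth_z1 : smooth (fun x => z1 (Htilde c x)).
Proof.
apply: smoothM; first exact: smooth_cst.
by apply: smooth_sum => al; exact: smooth_inner.
Qed.

Lemma smooth_z2 : smooth (fun x => z2 (Htilde c x)).
Proof.
apply: smoothM; first exact: smooth_cst.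
by apply: smooth_sum => al; apply: smooth_sum => be; apply: smoothM; exact: smooth_inner.
Qed.

Lemma smooth_J al m : smooth (fun x => J f (Htilde c x) al m).
Proof.
have cU : forall x, U (z1 (Htilde c x), z2 (Htilde c x)) by case: c_adm.
have -> : (fun x => J f (Htilde c x) al m) = (fun x =>
    partial1 f (z1 (Htilde c x)) (z2 (Htilde c x)) * Htilde c x al m +
    partial2 f (z1 (Htilde c x)) (z2 (Htilde c x)) *
      \sum_(be < 2) Htilde c x be m * inner (Htilde c x) be al).
  by apply/funext => x; rewrite mxE.
apply: smoothD; apply: smoothM.
- apply: smooth_comp2 cU smooth_z1 smooth_z2 => z Uz; exact/analytic_at_partial1/f_analytic.
- exact: smooth_Htilde.
- apply: smooth_comp2 cU smooth_z1 smooth_z2 => z Uz; exact/analytic_at_partial2/f_analytic.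
- by apply: smooth_sum => be; apply: smoothM; [exact: smooth_Htilde|exact: smooth_inner].
Qed.

Lemma smooth_Zfield al m : smooth (Zfield f c al m).
Proof.
apply: smoothM smooth_inv_norm.
by apply: smoothB; [exact: smooth_H|exact: smooth_J].
Qed.

Variable phi : 'rV[R]_4 -> R.
Hypothesis phi_smooth : smooth phi.

Lemma smooth_delta_gauge al m : smooth (delta_gauge f c phi al m).
Proof.
apply: smoothM; last by apply: smoothM smooth_inv_norm.
apply: smooth_sum => be; apply: smoothM; first exact: smooth_cst.
by apply: smoothB; [exact: smooth_H|exact: smooth_J].
Qed.

Lemma smooth_current m : smooth (current f c phi m).
Proof.
apply: smooth_sum => n; apply: smooth_sum => p; apply: smooth_sum => q.
apply: smoothM; first exact: smooth_cst.
apply: smoothM => //; apply: smoothB.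
  by apply: smoothM; [exact: smooth_u|apply: smoothM; exact: smooth_Zfield].
apply: smoothM; first exact: smooth_cst.
by apply: smoothD; apply: smoothM; [exact: smooth_Zfield|exact: smooth_F|exact: smooth_Zfield|exact: smooth_F].
Qed.

Lemma u_transform e m x : u (transform f c phi e) m x = u c m x + e * pd m phi x.
Proof.
case: c_adm => _ cs _ _.
rewrite /u /= pdD; [|exact: smooth_differentiable|].
  rewrite pdM; [|exact: smooth_differentiable (smooth_cst e)|exact: smooth_differentiable].
  by rewrite pd_cst mul0r add0r.
exact: smooth_differentiable (smoothM (smooth_cst e) phi_smooth).
Qed.

Lemma pd_gauge_transform e al m n x : pd m (gauge (transform f c phi e) al n) x =
  pd m (gauge c al n) x + e * pd m (delta_gauge f c phi al n) x.
Proof.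
case: c_adm => cg _ _ _; have ds := smooth_delta_gauge al n.
rewrite /= pdD; [|exact: smooth_differentiable|].
  rewrite pdM; [|exact: smooth_differentiable (smooth_cst e)|exact: smooth_differentiable].
  by rewrite pd_cst mul0r add0r.
exact: smooth_differentiable (smoothM (smooth_cst e) ds).
Qed.

(** The gauge variation is frozen at [c], so the field strength is affine in [e]. *)
Lemma F_transform e al m n x : F (transform f c phi e) al m n x =
  F c al m n x + e * (pd m (delta_gauge f c phi al n) x - pd n (delta_gauge f c phi al m) x).
Proof. by rewrite /F !pd_gauge_transform; ring. Qed.

End Smoothness.

Section PointVariation.
Variables (us w : vect) (T D : 'I_2 -> tens).
Hypothesis us0 : dot us us < 0.
Let s := Num.sqrt (- dot us us).
Let vs := unit_covector us.
Let k : vect := fun m => w m / s + vs m * dot vs w / s.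
Let ue (e : R) : vect := fun m => us m + e * w m.
Let Te (e : R) (al : 'I_2) : tens := fun m n => T al m n + e * D al m n.

Lemma is_derive_pt_contract al m :
  is_derive (0 : R) 1 (fun e => tcontract (unit_covector (ue e)) (Te e al) m)
    (tcontract k (T al) m + tcontract vs (D al) m).
Proof.
have u0 : ue 0 = us by apply/funext => n; rewrite /ue mul0r addr0.
have T0 : Te 0 al = T al by do 2!apply/funext => ?; rewrite /Te mul0r addr0.
have := @is_derive_tcontract R 0 (fun e => unit_covector (ue e)) (fun e => Te e al) k (D al) m.
rewrite u0 T0; apply; first by move=> n; exact: is_derive_unit_covector.
by move=> p q; exact: is_derive_affine.
Qed.

Lemma is_derive_pt_contract_hodge al m :
  is_derive (0 : R) 1 (fun e => tcontract (unit_covector (ue e)) (hodge (Te e al)) m)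
    (tcontract k (hodge (T al)) m + tcontract vs (hodge (D al)) m).
Proof.
have u0 : ue 0 = us by apply/funext => n; rewrite /ue mul0r addr0.
have T0 : Te 0 al = T al by do 2!apply/funext => ?; rewrite /Te mul0r addr0.
have := @is_derive_tcontract R 0 (fun e => unit_covector (ue e)) (fun e => hodge (Te e al)) k (hodge (D al)) m.
rewrite u0 T0; apply; first by move=> n; exact: is_derive_unit_covector.
by move=> p q; apply: is_derive_hodge => p' q'; exact: is_derive_affine.
Qed.

End PointVariation.

(** * The two invariances at a point of space-time *)

Section Variation.
Variables (f : R -> R -> R) (U : set (R * R)) (c : config R) (phi : 'rV[R]_4 -> R).
Hypothesis U_open : open U.
Hypothesis f_analytic : forall z, U z -> analytic_at f z.
Hypothesis f_equation : forall s1 s2 : R, U (s1, s2) ->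
  partial1 f s1 s2 ^+ 2 + 2 * s1 * partial1 f s1 s2 * partial2 f s1 s2
    + 2 * (s1 ^+ 2 - s2) * partial2 f s1 s2 ^+ 2 = 1.
Hypothesis c_adm : admissible U c.
Hypothesis phi_smooth : smooth phi.
Variable x : 'rV[R]_4.

Let us : vect := u c ^~ x.
Let w : vect := fun m => pd m phi x.
Let T (al : 'I_2) : tens := fun m n => F c al m n x.
Let P (al : 'I_2) : tens := fun m n => pd m (delta_gauge f c phi al n) x.
Let D (al : 'I_2) : tens := fun m n => P al m n - P al n m.
Let s := Num.sqrt (- dot us us).
Let vs := unit_covector us.
Let k : vect := fun m => w m / s + vs m * dot vs w / s.
Let ue (e : R) : vect := fun m => us m + e * w m.
Let Te (e : R) (al : 'I_2) : tens := fun m n => T al m n + e * D al m n.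
Let E1 := tcontract vs (T a0).
Let E2 := tcontract vs (T a1).
Let B1 := tcontract vs (hodge (T a0)).
Let B2 := tcontract vs (hodge (T a1)).
Let f1 := partial1 f (gram1 B1 B2) (gram2 B1 B2).
Let f2 := partial2 f (gram1 B1 B2) (gram2 B1 B2).

Let us0 : dot us us < 0.
Proof. by case: c_adm => _ _ /(_ x). Qed.

Let s0 : s != 0.
Proof. by rewrite gt_eqF// sqrtr_gt0 oppr_gt0. Qed.

Let vv : dot vs vs = -1.
Proof. exact: dot_unit_covector. Qed.

Let TN al : antisym (T al).
Proof. by move=> m n; rewrite /T /F opprB. Qed.

Let vB1 : dot vs B1 = 0. Proof. exact: dot_tcontract_self (hodge_antisym _). Qed.
Let vB2 : dot vs B2 = 0. Proof. exact: dot_tcontract_self (hodge_antisym _). Qed.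

Let BU : U (gram1 B1 B2, gram2 B1 B2).
Proof.
case: c_adm => _ _ _ /(_ x).
by rewrite z1E z2E HtildeE !pt_HtildeE.
Qed.

Let He e : H (transform f c phi e) x = pt_H (ue e) (Te e).
Proof.
rewrite HE; congr pt_H; first by apply/funext => m; exact: (u_transform f c_adm phi_smooth).
by do 3!apply/funext => ?; exact: (F_transform f_analytic c_adm phi_smooth).
Qed.

Let Hte e : Htilde (transform f c phi e) x = pt_Htilde (ue e) (Te e).
Proof.
rewrite HtildeE; congr pt_Htilde; first by apply/funext => m; exact: (u_transform f c_adm phi_smooth).
by do 3!apply/funext => ?; exact: (F_transform f_analytic c_adm phi_smooth).
Qed.

Let ue0 : ue 0 = us. Proof. by apply/funext => m; rewrite /ue mul0r addr0. Qed.
Let Te0 : Te 0 = T. Proof. by do 3!apply/funext => ?; rewrite /Te mul0r addr0. Qed.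

Let dE al m : is_derive (0 : R) 1
    (fun e => tcontract (unit_covector (ue e)) (Te e al) m)
    (tcontract k (T al) m + tcontract vs (D al) m) := is_derive_pt_contract w T D us0 al m.
Let dB al m : is_derive (0 : R) 1
    (fun e => tcontract (unit_covector (ue e)) (hodge (Te e al)) m)
    (tcontract k (hodge (T al)) m + tcontract vs (hodge (D al)) m) :=
  is_derive_pt_contract_hodge w T D us0 al m.

Let fa : analytic_at f (gram1 (tcontract (unit_covector (ue 0)) (hodge (Te 0 a0)))
    (tcontract (unit_covector (ue 0)) (hodge (Te 0 a1))),
  gram2 (tcontract (unit_covector (ue 0)) (hodge (Te 0 a0)))
    (tcontract (unit_covector (ue 0)) (hodge (Te 0 a1)))).
Proof. by rewrite ue0 Te0; exact: f_analytic. Qed.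

Let kv : dot k vs = 0.
Proof. exact: (dot_linear_rel vv (fun m => erefl (k m))). Qed.

Lemma self_duality_has_variation : self_dual f c -> forall al p, exists d : R,
  has_variation f c phi (fun c' => H c' x al p) d /\
  has_variation f c phi (fun c' => J f (Htilde c' x) al p) d.
Proof.
move=> sd.
(* Self-duality at every point is used: the variation of F involves derivatives of the gauge
   variation, not only its value at x. *)
have dg0 al m : delta_gauge f c phi al m = (fun=> 0).
  apply/funext => y; rewrite /delta_gauge big1 ?mul0r// => be _.
  by rewrite sd subrr mulr0.
have D0 al : D al = (fun _ _ => 0).
  by do 2!apply/funext => ?; rewrite /D /P !dg0 !pd_cst subrr.
have c0 a m : tcontract a (fun _ _ : 'I_4 => 0 : R) m = 0.
  by rewrite /tcontract big1// => n _; rewrite mulr0.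
have h0 : hodge (fun _ _ : 'I_4 => 0 : R) = (fun _ _ => 0).
  do 2!apply/funext => ?; rewrite /hodge big1 ?mulr0// => p _.
  by rewrite big1// => q _; rewrite !mulr0.
have SD1 m : - tcontract vs (T a1) m = curJ1 B1 B2 f1 f2 m.
  by have := sd a0 m x; rewrite HE pt_H0 J0E z1E z2E HtildeE !pt_HtildeE.
have SD2 m : tcontract vs (T a0) m = curJ2 B1 B2 f1 f2 m.
  by have := sd a1 m x; rewrite HE pt_H1 J1E z1E z2E HtildeE !pt_HtildeE.
have [V1 V2] := self_duality_variation (TN a0) (TN a1) vv kv
  (f_equation_derive1 U_open f_analytic f_equation BU)
  (f_equation_derive2 U_open f_analytic f_equation BU) (f_equation BU) SD1 SD2.
have dB' al m : is_derive (0 : R) 1 (fun e => tcontract (unit_covector (ue e)) (hodge (Te e al)) m)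
    (tcontract k (hodge (T al)) m).
  by apply: is_derive_eq (dB al m) _; rewrite D0 h0 c0 addr0.
have dE' al m : is_derive (0 : R) 1 (fun e => tcontract (unit_covector (ue e)) (Te e al) m)
    (tcontract k (T al) m).
  by apply: is_derive_eq (dE al m) _; rewrite D0 c0 addr0.
move=> al p; case: (ord2P al) => ->.
- exists (- tcontract k (T a1) p); rewrite /has_variation; split.
    have -> : (fun e => H (transform f c phi e) x a0 p) =
        (fun e => - tcontract (unit_covector (ue e)) (Te e a1) p).
      by apply/funext => e; rewrite He pt_H0.
    exact: is_deriveN_fun.
  have := is_derive_curJ1 (dB' a0) (dB' a1) fa p.
  rewrite ue0 Te0 -/vs -/B1 -/B2 -V1.
  congr (is_derive _ _ _ _); apply/funext => e.
  by rewrite J0E z1E z2E Hte !pt_HtildeE.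
- exists (tcontract k (T a0) p); rewrite /has_variation; split.
    have -> : (fun e => H (transform f c phi e) x a1 p) =
        (fun e => tcontract (unit_covector (ue e)) (Te e a0) p).
      by apply/funext => e; rewrite He pt_H1.
    exact: dE'.
  have := is_derive_curJ2 (dB' a0) (dB' a1) fa p.
  rewrite ue0 Te0 -/vs -/B1 -/B2 -V2.
  congr (is_derive _ _ _ _); apply/funext => e.
  by rewrite J1E z1E z2E Hte !pt_HtildeE.
Qed.

Lemma lagrangianE c' : lagrangian f c' x =
  2^-1 * (dot (H c' x a0) (Htilde c' x a0) + dot (H c' x a1) (Htilde c' x a1))
  - f (gram1 (Htilde c' x a0) (Htilde c' x a1)) (gram2 (Htilde c' x a0) (Htilde c' x a1)).
Proof. by rewrite /lagrangian sum2E z1E z2E. Qed.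

Let J1 := curJ1 B1 B2 f1 f2.
Let J2 := curJ2 B1 B2 f1 f2.
Let Z al : vect := fun m => Zfield f c al m x.
Let dZ al : tens := fun m n => pd m (Zfield f c al n) x.

Let dE1 m := tcontract k (T a0) m + tcontract vs (D a0) m.
Let dE2 m := tcontract k (T a1) m + tcontract vs (D a1) m.
Let dB1 m := tcontract k (hodge (T a0)) m + tcontract vs (hodge (D a0)) m.
Let dB2 m := tcontract k (hodge (T a1)) m + tcontract vs (hodge (D a1)) m.

Lemma lagrangian_has_variation : has_variation f c phi (fun c' => lagrangian f c' x)
  (2^-1 * (- dot dE2 B1 - dot E2 dB1 + dot dE1 B2 + dot E1 dB2) - dot J1 dB1 - dot J2 dB2).
Proof.
rewrite /has_variation.
have -> : (fun e => lagrangian f (transform f c phi e) x) = (fun e =>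
   2^-1 * (- dot (tcontract (unit_covector (ue e)) (Te e a1)) (tcontract (unit_covector (ue e)) (hodge (Te e a0)))
     + dot (tcontract (unit_covector (ue e)) (Te e a0)) (tcontract (unit_covector (ue e)) (hodge (Te e a1))))
   + - f (gram1 (tcontract (unit_covector (ue e)) (hodge (Te e a0))) (tcontract (unit_covector (ue e)) (hodge (Te e a1))))
     (gram2 (tcontract (unit_covector (ue e)) (hodge (Te e a0))) (tcontract (unit_covector (ue e)) (hodge (Te e a1))))).
  by apply/funext => e; rewrite lagrangianE He Hte !pt_HtildeE pt_H0 pt_H1 dotNl.
have d21 := is_derive_dot (dE a1) (dB a0); rewrite ue0 Te0 in d21.
have d12 := is_derive_dot (dE a0) (dB a1); rewrite ue0 Te0 in d12.
have df := is_derive_f_gram (dB a0) (dB a1) fa; rewrite ue0 Te0 in df.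
apply: is_derive_eq (is_deriveD_fun (is_deriveZ_fun _ (is_deriveD_fun
  (is_deriveN_fun d21) d12)) (is_deriveN_fun df)) _.
move: (dot _ B1) (dot E2 _) (dot _ B2) (dot E1 _) (dot J1 _) (dot J2 _) => *.
by rewrite !opprD !addrA.
Qed.

Let pd_dg0 m n : P a0 m n = - (dZ a1 m n * phi x + Z a1 n * w m).
Proof.
rewrite /P.
have -> : delta_gauge f c phi a0 n = (fun y => (-1) * (Zfield f c a1 n y * phi y)).
  by apply/funext => y; rewrite delta_gauge0 mulN1r.
have Zs := smooth_Zfield f_analytic c_adm a1 n.
have Zp := smoothM Zs phi_smooth.
rewrite pdM; [|exact: smooth_differentiable (smooth_cst _)|exact: smooth_differentiable].
rewrite pdM; [|exact: smooth_differentiable|exact: smooth_differentiable].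
by rewrite pd_cst mul0r add0r mulN1r.
Qed.

Let pd_dg1 m n : P a1 m n = dZ a0 m n * phi x + Z a0 n * w m.
Proof.
rewrite /P.
have -> : delta_gauge f c phi a1 n = (fun y => Zfield f c a0 n y * phi y).
  by apply/funext => y; rewrite delta_gauge1.
have Zs := smooth_Zfield f_analytic c_adm a0 n.
by rewrite pdM; [|exact: smooth_differentiable|exact: smooth_differentiable].
Qed.

Lemma pd_current m : pd m (current f c phi m) x =
  \sum_(n < 4) \sum_(p < 4) \sum_(q < 4) levi_civita m n p q *
    (4^-1 * (P a0 m n * T a1 p q - P a1 m n * T a0 p q)
     + us n * (w m * Z a0 p * Z a1 q + phi x * (dZ a0 m p * Z a1 q + Z a0 p * dZ a1 m q))
     + pd m (u c n) x * (phi x * (Z a0 p * Z a1 q))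
     - 4^-1 * phi x * (Z a1 n * pd m (F c a1 p q) x + Z a0 n * pd m (F c a0 p q) x)).
Proof.
have Zs := smooth_Zfield f_analytic c_adm; have Fs := smooth_F c_adm; have us' := smooth_u c_adm.
pose G n p q y := phi y * (u c n y * (Zfield f c a0 p y * Zfield f c a1 q y)
   + (- 4^-1) * (Zfield f c a1 n y * F c a1 p q y + Zfield f c a0 n y * F c a0 p q y)).
have ZZ p q := smoothM (Zs a0 p) (Zs a1 q).
have uZZ n p q := smoothM (us' n) (ZZ p q).
have ZF al n p q := smoothM (Zs al n) (Fs al p q).
have ZF2 n p q := smoothD (ZF a1 n p q) (ZF a0 n p q).
have cZF n p q := smoothM (smooth_cst (- 4^-1)) (ZF2 n p q).
have Gs n p q : smooth (G n p q) by apply: smoothM => //; exact: smoothD.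
have lG n p q : smooth (fun y => levi_civita m n p q * G n p q y).
  by apply: smoothM => //; exact: smooth_cst.
have -> : current f c phi m = (fun y => \sum_(n < 4) \sum_(p < 4) \sum_(q < 4)
    levi_civita m n p q * G n p q y).
  apply/funext => y; apply: eq_bigr => n _; apply: eq_bigr => p _; apply: eq_bigr => q _.
  by rewrite /G mulNr.
have sd g : smooth g -> differentiable g x by exact: smooth_differentiable.
rewrite pd_sum; last by move=> n; apply: sd; do 2!apply: smooth_sum => ?; exact: lG.
apply: eq_bigr => n _; rewrite pd_sum; last by move=> p; apply: sd; apply: smooth_sum => ?; exact: lG.
apply: eq_bigr => p _; rewrite pd_sum; last by move=> q; apply: sd; exact: lG.
apply: eq_bigr => q _; rewrite pdM; [|exact/sd/smooth_cst|exact/sd/Gs].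
rewrite pd_cst mul0r add0r; congr (_ * _).
rewrite /G pdM; [|exact: sd|exact/sd/smoothD].
rewrite pdD; [|exact: sd|exact: sd].
rewrite pdM; [|exact: sd|exact: sd].
rewrite pdM; [|exact: sd|exact: sd].
rewrite (pdM m (sd _ (smooth_cst (- 4^-1))) (sd _ (ZF2 n p q))).
rewrite pdD; [|exact: sd|exact: sd].
rewrite pdM; [|exact: sd|exact: sd].
rewrite pdM; [|exact: sd|exact: sd].
rewrite pd_cst pd_dg0 pd_dg1 /dZ /Z /T /us /w.
move: (phi x) (pd m phi x) (u c n x) (pd m (u c n) x) (F c a0 p q x) (F c a1 p q x)
  (pd m (F c a0 p q) x) (pd m (F c a1 p q) x) (Zfield f c a0 p x) (Zfield f c a1 q x)
  (Zfield f c a0 n x) (Zfield f c a1 n x) (pd m (Zfield f c a0 p) x) (pd m (Zfield f c a1 q) x)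
  (pd m (Zfield f c a0 n) x) (pd m (Zfield f c a1 n) x) => *; ring.
Qed.

Lemma divergence_current : \sum_(m < 4) pd m (current f c phi m) x =
  4^-1 * (\sum_(m < 4) \sum_(n < 4) \sum_(p < 4) \sum_(q < 4)
    levi_civita m n p q * (P a0 m n * T a1 p q - P a1 m n * T a0 p q))
  + \sum_(m < 4) \sum_(n < 4) \sum_(p < 4) \sum_(q < 4) levi_civita m n p q *
    (s * vs n * (w m * Z a0 p * Z a1 q + phi x * (dZ a0 m p * Z a1 q + Z a0 p * dZ a1 m q))).
Proof.
under eq_bigr do rewrite pd_current.
case: c_adm => cg cs _ _.
have usym m n : pd m (u c n) x = pd n (u c m) x by exact: pd_comm.
pose S al m p q := pd m (pd p (gauge c al q)) x.
have Ssym al m p q : S al m p q = S al p m q by exact: pd_comm.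
have dF al m p q : pd m (F c al p q) x = S al m p q - S al m q p.
  rewrite /F.
  have -> : (fun y => pd p (gauge c al q) y - pd q (gauge c al p) y) =
    (fun y => pd p (gauge c al q) y + (-1) * pd q (gauge c al p) y).
    by apply/funext => y; rewrite mulN1r.
  have s1 := smooth_pd p (cg al q); have s2 := smooth_pd q (cg al p).
  rewrite pdD; [|exact: smooth_differentiable|].
    rewrite pdM; [|exact: smooth_differentiable (smooth_cst _)|exact: smooth_differentiable].
    by rewrite pd_cst mul0r add0r mulN1r.
  exact: smooth_differentiable (smoothM (smooth_cst _) s2).
have usv n : us n = s * vs n by rewrite /vs /unit_covector -/s; field.
under eq_bigr do under eq_bigr do under eq_bigr do under eq_bigr do rewrite !dF.
rewrite (divergence_closed (P a0) (P a1) (T a0) (T a1) (dZ a0) (dZ a1) (Z a0) (Z a1) us w (phi x)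
  usym (Ssym a0) (Ssym a1)).
congr (_ + _); do 2![apply: eq_bigr => ? _]; do 2![apply: eq_bigr => ? _]; by rewrite usv.
Qed.

Lemma lagrangian_variation_current :
  has_variation f c phi (fun c' => lagrangian f c' x) (\sum_(m < 4) pd m (current f c phi m) x).
Proof.
apply: is_derive_eq lagrangian_has_variation _; rewrite divergence_current.
(* This is the one place where the equation of [f] enters the invariance of the action. *)
have volJ : vol vs w J1 J2 = vol vs w B1 B2.
  by rewrite vol_curJ -/(gram1 B1 B2) -/(gram2 B1 B2) f_equation// mul1r.
have vJ1 : dot vs J1 = 0 by exact: dot_v_curJ1.
have vJ2 : dot vs J2 = 0 by exact: dot_v_curJ2.
apply: (lagrangian_variation (TN a0) (TN a1) vv s0 _ vJ1 vJ2 volJ) => //.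
- by move=> m; rewrite /Z /Zfield /pt_Z pt_H0 J0E z1E z2E !pt_HtildeE.
- by move=> m; rewrite /Z /Zfield /pt_Z pt_H1 J1E z1E z2E !pt_HtildeE.
Qed.

End Variation.
End Fields.

Unset Implicit Arguments.

Theorem mainTheorem3 (R : realType) (f : R -> R -> R) (U : set (R * R))
  (U_open : open U) (U_origin : U (0, 0))
  (f_analytic : forall z : R * R, U z -> analytic_at f z)
  (f_weak_field : forall h : 'M[R]_(2, 4),
     t ^- 2 * f (z1 (t *: h)) (z2 (t *: h)) @[t --> (0 : R)^'] --> z1 h)
  (f_equation : forall s1 s2 : R, U (s1, s2) ->
     partial1 f s1 s2 ^+ 2 + 2 * s1 * partial1 f s1 s2 * partial2 f s1 s2
       + 2 * (s1 ^+ 2 - s2) * partial2 f s1 s2 ^+ 2 = 1) :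
  (* J^alpha_p is the derivative of f with respect to h^(alpha p), the
     component with upper Lorentz index, h_p = metric p * h^p *)
  (forall h : 'M[R]_(2, 4), U (z1 h, z2 h) -> forall (al : 'I_2) (p : 'I_4),
     is_derive h (metric p *: delta_mx al p) (fun h' => f (z1 h') (z2 h'))
       (J f h al p)) /\
  self_duality_invariant f U /\
  action_invariant f U.
Proof.
split; first exact: J_is_derive f_analytic.
split.
  move=> c phi c_adm phi_smooth sd al p x.
  exact: (self_duality_has_variation U_open f_analytic f_equation c_adm phi_smooth x sd).
exists 1%N, (kappa f) => c phi c_adm phi_smooth; split=> [m|x].
  by rewrite local_currentE; exact: (smooth_current f_analytic c_adm phi_smooth).
under eq_bigr do rewrite local_currentE.
exact: (lagrangian_variation_current f_analytic f_equation c_adm phi_smooth x).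
Qed.
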